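(* Let $0<a_-\le1\le a_+<\infty$. There is a constant $C>0$ depending only on $a_-,a_+$ such that the following holds. Let $n\ge1$ and $\delta\in(0,1/3)$. Assume that the noise $\epsilon=Y-g(X)$ is sub-Gaussian conditionally on $X$ with parameter $\sigma^2$, that $g$ is $L$-Lipschitz on $S_X$, and that the local map $\mathcal V$ (possibly random and data-dependent) is VC with dimension $v$, is $(\delta,n)$-large, satisfies the minimal mass assumption with constant $\kappa>0$ and density $f_X$, is $\gamma$-shape-regular for some $\gamma>0$, and satisfies, for all $x\in S_X$, $$a_-\,\lambda(\mathcal V(x))\ \le\ \left(\frac{\log\left((n+1)^v/\delta\right)}{n}\right)^{d/(d+2)}\ \le\ a_+\,\lambda(\mathcal V(x)).$$ Then, with probability at least $1-3\delta$, for all $x\in S_X$, $$|\hat g_{\mathcal V}(x)-g(x)|\ \le\ C\left(\sqrt{\frac{3\sigma^2}{\kappa f_X(x)}}+L(\mathcal V(x))\,\gamma^{1/d}\right)\left(\frac{\log\left((n+1)^v/\delta\right)}{n}\right)^{1/(d+2)}.$$ In addition, if $S_X$ is bounded and $f_X(x)\ge b>0$ for all $x\in S_X$, then, with probability at least $1-3\delta$, $$\sup_{x\in S_X}|\hat g_{\mathcal V}(x)-g(x)|\ \le\ C\left(\sqrt{\frac{3\sigma^2}{\kappa b}}+L\,\gamma^{1/d}\right)\left(\frac{\log\left((n+1)^v/\delta\right)}{n}\right)^{1/(d+2)}.$$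
   Context: Regression model: $(X,Y)$ is a random vector, $X$ takes values in $S_X\subset\mathbb R^d$ ($d\ge1$), $Y$ is real valued, $g(x)=\mathbb E[Y\mid X=x]$, $\epsilon=Y-g(X)$; $(X_1,Y_1),\dots,(X_n,Y_n)$ are i.i.d. copies of $(X,Y)$. For a set $A$, $\mathbb P(A)$ is the law of $X$ evaluated at $A$ (for a random set $A$, this is the random number obtained by evaluating the law of $X$ at the realized set), and $\mathbb P_n(A)=\frac1n\sum_{i=1}^n\mathbf 1_A(X_i)$. $\lambda$ is Lebesgue measure on $\mathbb R^d$. Conditionally sub-Gaussian with parameter $\sigma^2$: $\mathbb E[\epsilon\mid X]=0$ and $\mathbb E[\exp(t\epsilon)\mid X]\le \exp(\sigma^2t^2/2)$ for all $t\in\mathbb R$. A local map is a map $\mathcal V:S_X\to\mathcal B(S_X)$ (Borel subsets of $S_X$) with $x\in\mathcal V(x)$ for all $x$, each $\mathcal V(x)$ having positive Lebesgue measure. It may be random and may depend on the whole sample and on additional randomness. The associated estimator is $\hat g_{\mathcal V}(x)=\frac{\sum_{i=1}^nY_i\mathbf 1_{\mathcal V(x)}(X_i)}{\sum_{i=1}^n\mathbf 1_{\mathcal V(x)}(X_i)}$, with $0/0=0$. $\mathcal V$ is VC with dimension $v$ if $\{\mathcal V(x):x\in S_X\}\subset\mathcal A$ for a fixed (deterministic) collection $\mathcal A$ of subsets of $\mathbb R^d$ with finite Vapnik–Chervonenkis dimension $v>0$. $(\delta,n)$-large: almost surely, for all $x\in S_X$, $n\max(\mathbb P_n(\mathcal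 V(x)),\mathbb P(\mathcal V(x)))\ge 8\log\left(\frac{4(2n+1)^v}{\delta}\right)$. Minimal mass assumption: there are $\kappa>0$ and a density function $f_X$ (the density of $X$) such that, almost surely, for all $x\in S_X$, $\mathbb P(\mathcal V(x))\ge\kappa f_X(x)\lambda(\mathcal V(x))$. $\operatorname{diam}(V)=\sup_{x,y\in V}\|x-y\|_2$. The local map is $\gamma$-shape-regular if $\operatorname{diam}(\mathcal V(x))^d\le\gamma\lambda(\mathcal V(x))$ for all $x\in S_X$. For $V\subset S_X$, $L(V)$ is the smallest constant $L$ with $|g(x)-g(y)|\le L\|x-y\|_2$ for all $x,y\in V$. The right-hand side of the first bound is read as $+\infty$ if $f_X(x)=0$.
   Formalization: The fixed VC collection containing the cells is also assumed measurable in the usual empirical-process sense (the set of N-tuples with a given trace is universally measurable); without it, under the continuum hypothesis, the bound can fail on every outcome. *)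

(* Defs.v *)
From HB Require Import structures.
From mathcomp Require Import all_boot all_order all_algebra.
From mathcomp Require Import all_classical all_reals all_analysis.

Set Implicit Arguments.
Unset Strict Implicit.
Unset Printing Implicit Defensive.

Import Order.TTheory GRing.Theory Num.Theory.
Import numFieldNormedType.Exports.

Local Open Scope classical_set_scope.
Local Open Scope ring_scope.

(* R^d is d.-tuple R, with the library's product sigma-algebra, that is, its
   Borel sigma-algebra. *)

(* lebesgue_measure lives on the alias measurableTypeR R; this is the same set
   function over R itself, which carries the same measurable sets. *)
Definition lebesgue1 {R : realType} : set R -> \bar R := @lebesgue_measure R.

Section lebesgue1_measure.
Context {R : realType}.

Let lebesgue1_0 : @lebesgue1 R set0 = 0%E.
Proof. exact: (measure0 (@lebesgue_measure R)). Qed.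

Let lebesgue1_ge0 (A : set R) : (0 <= @lebesgue1 R A)%E.
Proof. exact: (measure_ge0 (@lebesgue_measure R)). Qed.

Let lebesgue1_sigma_additive : semi_sigma_additive (@lebesgue1 R).
Proof. exact: (@measure_semi_sigma_additive _ _ _ (@lebesgue_measure R)). Qed.

HB.instance Definition _ := isMeasure.Build _ R R (@lebesgue1 R)
  lebesgue1_0 lebesgue1_ge0 lebesgue1_sigma_additive.

Let lebesgue1_sigma_finite : sigma_finite setT (@lebesgue1 R).
Proof. exact: (sigma_finiteT (@lebesgue_measure R)). Qed.

HB.instance Definition _ := Measure_isSigmaFinite.Build _ R R (@lebesgue1 R)
  lebesgue1_sigma_finite.

End lebesgue1_measure.

Section lebesgue_vec.
Context {R : realType}.
Local Open Scope ereal_scope.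

Definition tcons d (p : R * d.-tuple R) : d.+1.-tuple R :=
  [the d.+1.-tuple R of p.1 :: p.2].

(* Lebesgue measure on R^d, as the iterated product of lebesgue1; see
   lebesgue_vec_box for its values on boxes. *)
Fixpoint lebesgue_vec d : set (d.-tuple R) -> \bar R :=
  match d with
  | 0 => dirac ([tuple] : 0.-tuple R)
  | d'.+1 => pushforward (lebesgue1 \x @lebesgue_vec d') (@tcons d')
  end.

Lemma measurable_tcons d : measurable_fun setT (@tcons d).
Proof. exact: measurable_cons. Qed.

Section tpush.
Variables (d : nat) (mu : {sigma_finite_measure set (d.-tuple R) -> \bar R}).
Local Notation nu := (lebesgue1 \x mu).

Definition tpush := pushforward nu (@tcons d).

Let tpush0 : tpush set0 = 0.
Proof. by rewrite /tpush /pushforward preimage_set0 measure0. Qed.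

Let tpush_ge0 A : 0 <= tpush A.
Proof. exact: (measure_ge0 nu). Qed.

Let tpush_sigma_additive : semi_sigma_additive tpush.
Proof. by apply: measure_semi_sigma_additive; exact: measurable_tcons. Qed.

HB.instance Definition _ := isMeasure.Build _ _ _ tpush
  tpush0 tpush_ge0 tpush_sigma_additive.

Let tpush_sigma_finite : sigma_finite setT tpush.
Proof.
have /sigma_finiteP[F [FT ndF Foo]] := sigma_finiteT (@lebesgue1 R).
have /sigma_finiteP[G [GT ndG Goo]] := sigma_finiteT mu.
pose unc (t : d.+1.-tuple R) := (thead t, [tuple of behead t]).
have munc : measurable_fun setT unc.
  apply: measurable_fun_pair; first exact: measurable_tnth.
  exact: measurable_behead.
have uncK : cancel (@tcons d) unc.
  by move=> [x t]; congr pair; exact/val_inj.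
exists (fun n => unc @^-1` (F n `*` G n)).
  apply/esym; rewrite -preimage_bigcup -subTset => t _ /=.
  have [n _ Fn] : (\bigcup_n F n) (unc t).1 by rewrite -FT.
  have [k _ Gk] : (\bigcup_n G n) (unc t).2 by rewrite -GT.
  exists (maxn n k) => //; split.
  - by move: Fn; exact/subsetPset/ndF/leq_maxl.
  - by move: Gk; exact/subsetPset/ndG/leq_maxr.
move=> n; have [mF Fn] := Foo n; have [mG Gn] := Goo n; split.
  by rewrite -[X in measurable X]setTI; apply: munc => //; exact: measurableX.
rewrite /tpush /pushforward (_ : _ @^-1` _ = F n `*` G n).
  by rewrite product_measure1E// lte_mul_pinfty// ge0_fin_numE.
by rewrite -comp_preimage (_ : unc \o _ = id)//; apply/funext.
Qed.

HB.instance Definition _ := Measure_isSigmaFinite.Build _ _ _ tpush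
  tpush_sigma_finite.

End tpush.

Lemma lebesgue_vec_sigma_finite_measure d :
  exists mu : {sigma_finite_measure set (d.-tuple R) -> \bar R},
    mu = @lebesgue_vec d :> (set (d.-tuple R) -> \bar R).
Proof.
elim: d => [|d [mu IH]] /=; first by exists (dirac ([tuple] : 0.-tuple R)).
by exists (tpush mu); rewrite -IH.
Qed.

Section lebesgue_vec_measure.
Variable d : nat.

Let lebesgue_vec0 : @lebesgue_vec d set0 = 0.
Proof. by have [mu <-] := lebesgue_vec_sigma_finite_measure d. Qed.

Let lebesgue_vec_ge0 A : 0 <= @lebesgue_vec d A.
Proof.
by have [mu <-] := lebesgue_vec_sigma_finite_measure d; exact: measure_ge0.
Qed.

Let lebesgue_vec_sigma_additive : semi_sigma_additive (@lebesgue_vec d).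
Proof.
have [mu <-] := lebesgue_vec_sigma_finite_measure d.
exact: measure_semi_sigma_additive.
Qed.

HB.instance Definition _ := isMeasure.Build _ _ _ (@lebesgue_vec d)
  lebesgue_vec0 lebesgue_vec_ge0 lebesgue_vec_sigma_additive.

Let lebesgue_vec_sigma_finite : sigma_finite setT (@lebesgue_vec d).
Proof.
by have [mu <-] := lebesgue_vec_sigma_finite_measure d; exact: sigma_finiteT.
Qed.

HB.instance Definition _ := Measure_isSigmaFinite.Build _ _ _ (@lebesgue_vec d)
  lebesgue_vec_sigma_finite.

End lebesgue_vec_measure.

Lemma lebesgue_vec_box d (B : 'I_d -> set R) :
  (forall i, measurable (B i)) ->
  lebesgue_vec [set x : d.-tuple R | forall i, B i (tnth x i)] =
  \prod_(i < d) lebesgue_measure (B i).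
Proof.
elim: d B => [|d IH] B mB.
  by rewrite big_ord0 /= diracE mem_set// => -[].
pose B' (i : 'I_d) := B (lift ord0 i).
have mbox : measurable [set t : d.-tuple R | forall i, B' i (tnth t i)].
  rewrite (_ : [set _ | _] =
      \bigcap_(i in [set: 'I_d]) (fun t : d.-tuple R => tnth t i) @^-1` B' i).
    apply: fin_bigcap_measurable => // i _.
    by rewrite -[X in measurable X]setTI; apply: measurable_tnth; [|exact: mB].
  by apply/seteqP; split => [t h i _|t h i]; [exact: h|exact: (h i I)].
rewrite big_ord_recl /= -(IH B'); last by move=> i; exact: mB.
rewrite /pushforward.
rewrite (_ : _ @^-1` _ =
    B ord0 `*` [set t : d.-tuple R | forall i, B' i (tnth t i)]).
  exact: product_measure1E.
apply/seteqP; split => -[x t] /=.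
  move=> h; split => [|i]; first exact: (h ord0).
  by have := h (lift ord0 i); rewrite tnthS.
move=> [hx ht] i; case: (unliftP ord0 i) => [j ->|->] //.
by rewrite tnthS; exact: ht.
Qed.

End lebesgue_vec.
Arguments lebesgue_vec {R d}.

Section euclidean.
Context {R : realType} {d : nat}.
Implicit Types (x y : d.-tuple R) (V : set (d.-tuple R)) (g : d.-tuple R -> R).

Definition edist x y : R :=
  Num.sqrt (\sum_(i < d) (tnth x i - tnth y i) ^+ 2).

Definition ediam V : \bar R :=
  ereal_sup [set (edist p.1 p.2)%:E | p in V `*` V].

Definition ebounded V : Prop :=
  exists M : R, forall x, V x -> edist x [tuple 0 | i < d] <= M.

Definition elipschitz (L : R) V g : Prop :=
  forall x y, V x -> V y -> `|g x - g y| <= L * edist x y.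

(* L(V); the condition 0 <= l only matters when V has at most one point. *)
Definition lipschitz_const g V : R := inf [set l | 0 <= l /\ elipschitz l V g].

End euclidean.

Section vc.
Context {T : Type}.
Implicit Types (AA : set (set T)) (F : set T).

Definition shatters AA F : Prop :=
  forall G, G `<=` F -> exists2 A, AA A & A `&` F = G.

Definition has_vc_dim AA (v : nat) : Prop :=
  (exists2 F : set T, (F #= `I_v)%card & shatters AA F) /\
  (forall (F : set T) (k : nat), (F #= `I_k)%card -> shatters AA F -> (k <= v)%N).

End vc.

Definition universally_measurable (R : realType) (dT : measure_display)
    (T : measurableType dT) (A : set T) : Prop :=
  forall mu : probability T R, exists B1 B2 : set T,
    [/\ measurable B1, measurable B2, B1 `<=` A, A `<=` B2 &
        mu (B2 `\` B1) = 0%E].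

(* The usual measurability proviso on a class AA over which empirical measures
   are controlled uniformly: for each N and each set I of indices, the N-tuples
   whose points lying in some common A in AA are exactly those with index in I
   form a universally measurable set. Finite VC dimension alone does not give
   uniform deviation bounds: under the continuum hypothesis the initial segments
   of a well-order of [0, 1] of type omega_1 are countable, have VC dimension 1,
   and one of them contains any given sample. *)
Definition measurable_class (R : realType) (dT : measure_display)
    (T : measurableType dT) (AA : set (set T)) : Prop :=
  forall (N : nat) (I : {set 'I_N}),
    @universally_measurable R _ (N.-tuple T)
      [set z | exists2 A, AA A & forall i, A (tnth z i) <-> i \in I].

Section probability.
Context {R : realType} {dO : measure_display} {Omega : measurableType dO}.
Variable P : probability Omega R.

(* Inner probability: the event described by E need not be measurable. *)
Definition with_prob_ge (p : R) (E : Omega -> Prop) : Prop :=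
  exists F : set Omega, [/\ measurable F, (p%:E <= P F)%E & forall w, F w -> E w].

Definition mutually_independent (dT : measure_display) (T : measurableType dT)
    (n : nat) (Z : 'I_n -> Omega -> T) : Prop :=
  forall (J : {set 'I_n}) (B : 'I_n -> set T), (forall i, measurable (B i)) ->
    P [set w | forall i, i \in J -> B i (Z i w)] =
    (\prod_(i in J) P (Z i @^-1` B i))%E.

Definition iid_copies (dT : measure_display) (T : measurableType dT)
    (n : nat) (Z : Omega -> T) (Zs : 'I_n -> Omega -> T) : Prop :=
  mutually_independent Zs /\
  forall (i : 'I_n) (B : set T), measurable B -> P (Zs i @^-1` B) = P (Z @^-1` B).

(* h is a version of x |-> E[Z | X = x]. *)
Definition is_cond_exp (dT : measure_display) (T : measurableType dT)
    (X : Omega -> T) (Z : Omega -> R) (h : T -> R) : Prop :=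
  [/\ P.-integrable setT (EFin \o Z), measurable_fun setT h,
      P.-integrable setT (EFin \o (h \o X)) &
      forall A : set T, measurable A ->
        (\int[P]_(w in X @^-1` A) (h (X w))%:E =
         \int[P]_(w in X @^-1` A) (Z w)%:E)%E].

Definition cond_sub_gaussian (dT : measure_display) (T : measurableType dT)
    (X : Omega -> T) (eps : Omega -> R) (sigma2 : R) : Prop :=
  is_cond_exp X eps (cst 0) /\
  forall t : R, exists2 h : T -> R,
    is_cond_exp X (fun w => expR (t * eps w)) h &
    {ae P, forall w, h (X w) <= expR (sigma2 * t ^+ 2 / 2)}.

Definition is_density (d : nat) (X : {RV P >-> d.-tuple R})
    (f : d.-tuple R -> R) : Prop :=
  [/\ measurable_fun setT f, (forall x, 0 <= f x) &
      forall A : set (d.-tuple R), measurable A ->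
        distribution P X A = (\int[lebesgue_vec]_(x in A) (f x)%:E)%E].

End probability.

Section local_regression.
Context {R : realType} {d : nat}.
Implicit Types (S : set (d.-tuple R)) (V : d.-tuple R -> set (d.-tuple R)).

(* One realization of a local map; V is unconstrained outside S. *)
Definition local_map S V : Prop :=
  forall x, S x ->
    [/\ measurable (V x), V x `<=` S, V x x & (0 < lebesgue_vec (V x))%E].

Definition empirical_measure (n : nat) (xs : 'I_n -> d.-tuple R)
    (A : set (d.-tuple R)) : R :=
  n%:R^-1 * \sum_(i < n) \1_A (xs i).

Definition local_estimator (n : nat) (xs : 'I_n -> d.-tuple R) (ys : 'I_n -> R)
    V (x : d.-tuple R) : R :=
  (\sum_(i < n) ys i * \1_(V x) (xs i)) / (\sum_(i < n) \1_(V x) (xs i)).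

End local_regression.

Definition log_ratio {R : realType} (n v : nat) (delta : R) : R :=
  ln (n.+1%:R ^+ v / delta) / n%:R.

(* Main.v *)
Require Import Defs.
From HB Require Import structures.
From mathcomp Require Import all_boot all_order all_algebra.
From mathcomp Require Import all_classical all_reals all_analysis.
From mathcomp Require Import measurable_realfun ring lra.

(** Write l for log ((n + 1)^v / delta) and N for the number of sample points in
the cell V(x).  The error of the local average splits into a noise part, the
average of the epsilon_i over the cell, and a bias part, the average of
g(X_i) - g(x) over the cell ([local_estimator_error]).  The bias is at most
L(V(x)) diam V(x), and shape regularity with the upper bound on the volume makes
the diameter of order gamma^(1/d) (l/n)^(1/(d+2)) ([bias_rate]).  The noise part
is of order sqrt (sigma^2 l / N); minimal mass with the lower bound on the volume
makes the mass of the cell at least of order kappa f_X(x) (l/n)^(d/(d+2)), so the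
rate follows once N is at least a fixed fraction of n times that mass
([noise_rate]).  The cell depends on the data, so both the bound on the noise and
the comparison of N with the mass have to hold at once for every A in the class
AA that contains the cells.

A class of VC dimension v cuts out at most (k + 1)^v traces on k points
([card_traces], from the theorem of Sauer and Shelah).  Which index sets are
traces depends on the points; instead of conditioning on the points, each index
set J is weighted with the probability that J is a trace.  These weights add up
to the expected number of traces, hence to at most (k + 1)^v ([trace_approx]),
and a union bound over all 2^k index sets with these weights costs no more than
one over the traces.  That J is a trace is only a universally measurable event,
so it is replaced by measurable ones: from inside for the sum of the weights, from
outside for the covering.

Noise ([noise_uniform]).  For a fixed J, a Chernoff bound is needed that retains
the probability that J is a trace as a factor.  It comes from [joint_mgf_le]: in
an expectation over an event that depends on the covariates only, the
exponentials of the noise can be replaced by their conditional expectations, and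
these are bounded by the sub-Gaussian assumption.

Mass ([mass_bound]).  This is the symmetrization of Vapnik and Chervonenkis.  If
the sample has far too few points in A, then with probability at least 1/2 an
independent second sample has many more, so some trace on the 2n points is
unbalanced between the two halves.  The law of the 2n points is invariant under
exchanging the i-th points of the two samples, for all i in any chosen set, and
for l' = log (4 (2n + 1)^v / delta) a given trace is made unbalanced by at most a
fraction exp (- l') of the 2^n exchanges ([card_unbalanced_swaps]).

The two bounds fail with probability at most 2 delta and delta / 2
([good_event]); outside these events the argument is deterministic. *)

Set Implicit Arguments.
Unset Strict Implicit.
Unset Printing Implicit Defensive.

Import Order.TTheory GRing.Theory Num.Theory.
Import numFieldNormedType.Exports.

(** * Sauer-Shelah bound on the number of traces *)

Section sauer_shelah.
Variable I : finType.
Implicit Types (F : {set {set I}}) (S U : {set I}).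

Definition shattered F : {set {set I}} :=
  [set S : {set I} | [forall U : {set I}, (U \subset S) ==>
     [exists A : {set I}, (A \in F) && (A :&: S == U)]]]%SET.

Lemma shatteredP F S :
  reflect (forall U, U \subset S -> exists2 A, A \in F & A :&: S = U)
          (S \in shattered F).
Proof.
rewrite inE; apply: (iffP forallP) => h U.
  move=> US; have /implyP/(_ US)/existsP[A /andP[AF /eqP AS]] := h U.
  by exists A.
by apply/implyP => US; have [A AF AS] := h _ US; apply/existsP; exists A;
  rewrite AF AS eqxx.
Qed.

(** Pajor's form of the Sauer-Shelah theorem.  Split F by membership of a point x
that separates two of its sets.  A set shattered by either half omits x and is
shattered by F; a set shattered by both halves accounts for two sets shattered by
F, itself and the one with x added. *)
Lemma card_le_shattered F : (#|F| <= #|shattered F|)%N.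
Proof.
have [n] := ubnP #|F|; elim: n F => // n IH F; rewrite ltnS => Fn.
have [F1|F1] := leqP #|F| 1.
  have [->|[A AF]] := set_0Vmem F; first by rewrite cards0.
  apply: (leq_trans F1); rewrite card_gt0; apply/set0Pn.
  exists finset.set0.
  apply/shatteredP => U; rewrite finset.subset0 => /eqP ->.
  by exists A; rewrite // finset.setI0.
have [A [B [AF BF AB]]] : exists A B, [/\ A \in F, B \in F & A != B].
  by move/card_gt1P: F1.
wlog [x xA xB] : A B AF BF AB / exists2 x, x \in A & x \notin B.
  move=> th; have [AsB|/subsetPn] := boolP (A \subset B); last exact: th AF BF AB.
  apply: (th B A) => //; first by rewrite eq_sym.
  by apply/subsetPn; apply: contra AB => BA; rewrite finset.eqEsubset AsB.
pose F1' := [set C in F | x \in C]%SET; pose F0' := [set C in F | x \notin C]%SET.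
have cF : (#|F| = #|F1'| + #|F0'|)%N.
  rewrite -(cardsID [set C : {set I} | x \in C]%SET F); congr (_ + _)%N;
    by apply: eq_card => C; rewrite !inE andbC // andbC.
have lt1 : (#|F1'| < n)%N.
  apply: leq_trans Fn; rewrite cF -addn1 leq_add2l card_gt0.
  by apply/set0Pn; exists B; rewrite inE BF.
have lt0 : (#|F0'| < n)%N.
  apply: leq_trans Fn; rewrite cF addnC -addn1 leq_add2l card_gt0.
  by apply/set0Pn; exists A; rewrite inE AF.
have x1 S : S \in shattered F1' -> x \notin S.
  move=> /shatteredP h; have [C] := h _ (finset.sub0set S).
  rewrite inE => /andP[_ xC] CS; apply/negP => xS.
  by have := finset.in_set0 x; rewrite -CS inE xC xS.
have x0 S : S \in shattered F0' -> x \notin S.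
  move=> /shatteredP h; have [C] := h _ (subxx S).
  rewrite inE => /andP[_ xC] CS; apply: contra xC => xS.
  by move: xS; rewrite -{1}CS inE => /andP[].
have sub1 S : S \in shattered F1' -> S \in shattered F.
  move=> /shatteredP h; apply/shatteredP => U /h[C].
  by rewrite inE => /andP[CF _] CS; exists C.
have sub0 S : S \in shattered F0' -> S \in shattered F.
  move=> /shatteredP h; apply/shatteredP => U /h[C].
  by rewrite inE => /andP[CF _] CS; exists C.
rewrite cF; apply: (leq_trans (leq_add (IH _ lt1) (IH _ lt0))).
rewrite -cardsUI.
(* the sets shattered by both halves, counted a second time with x added *)
pose G := [set x |: S | S in shattered F1' :&: shattered F0']%SET.
have cG : #|G| = #|shattered F1' :&: shattered F0'|.
  apply: card_in_imset => S S'; rewrite !finset.in_setI => /andP[S1 _] /andP[S1' _] e.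
  by rewrite -(setU1K (x1 _ S1)) e setU1K// x1.
rewrite -cG -cardsUI.
have -> : (shattered F1' :|: shattered F0') :&: G = finset.set0.
  apply/setP => S; rewrite finset.in_setI finset.in_set0; apply/negbTE/negP.
  rewrite finset.in_setU => /andP[SS /imsetP[S' _ e]].
  have xS : x \in S by rewrite e setU11.
  by move/orP: SS => [/x1|/x0]; rewrite xS.
rewrite cards0 addn0; apply: subset_leq_card; apply/fintype.subsetP => S.
rewrite finset.in_setU => /orP[|]; first by rewrite finset.in_setU => /orP[/sub1|/sub0].
move=> /imsetP[S' ]; rewrite finset.in_setI => /andP[S1 S0] ->{S}.
have xS' := x1 _ S1.
apply/shatteredP => U US.
have USx : U :\ x \subset S'.
  by apply/fintype.subsetP => y; rewrite !inE => /andP[yx /(fintype.subsetP US)];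
    rewrite !inE (negbTE yx).
have [xU|xU] := boolP (x \in U).
  have /shatteredP/(_ _ USx)[C] := S1; rewrite inE => /andP[CF xC] CS.
  exists C => //; rewrite finset.setIUr CS.
  have -> : C :&: [set x]%SET = [set x]%SET.
    by apply/finset.setIidPr; rewrite finset.sub1set.
  by rewrite finset.setD1K.
have /shatteredP/(_ _ USx)[C] := S0; rewrite inE => /andP[CF xC] CS.
exists C => //; rewrite finset.setIUr CS.
have -> : C :&: [set x]%SET = finset.set0.
  by apply/setP => y; rewrite !inE; case: eqP => [->|]; rewrite ?andbF// (negbTE xC).
rewrite finset.set0U; apply/setP => y; rewrite !inE; case: eqP => // ->.
by rewrite (negbTE xU).
Qed.

(** A set of at most v elements is the image of an enumeration by 'I_v padded with
None, and there are (#|I| + 1)^v functions from 'I_v to option I. *)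
Lemma card_small_subsets v :
  (#|[set S : {set I} | #|S| <= v]%SET| <= #|I|.+1 ^ v)%N.
Proof.
pose f (h : {ffun 'I_v -> option I}) : {set I} :=
  [set x | Some x \in codom h]%SET.
have fP : [set S : {set I} | #|S| <= v]%SET \subset [set f h | h in finset.setT]%SET.
  apply/fintype.subsetP => S; rewrite inE => Sv; apply/imsetP.
  exists [ffun i : 'I_v => nth None [seq Some x | x <- enum S] i] => //.
  apply/setP => x; rewrite inE; apply/idP/idP.
    move=> xS; apply/codomP.
    have iS : (index x (enum S) < v)%N.
      by apply: leq_trans Sv; rewrite cardE index_mem mem_enum.
    exists (Ordinal iS); rewrite ffunE (nth_map x) ?index_mem ?mem_enum//=.
    by rewrite nth_index// mem_enum.
  move=> /codomP[i]; rewrite ffunE => e.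
  have iS : (i < size (enum S))%N.
    rewrite ltnNge; apply/negP => iS; move: e.
    by rewrite nth_default// size_map.
  move: e; rewrite (nth_map x)// => -[->].
  by rewrite -(mem_enum S) mem_nth.
apply: (leq_trans (subset_leq_card fP)); apply: (leq_trans (leq_imset_card _ _)).
by rewrite cardsT card_ffun card_option card_ord.
Qed.

End sauer_shelah.

Local Open Scope classical_set_scope.

(** The sets whose universal measurability [measurable_class] asserts. *)
Definition trace_set T (AA : set (set T)) N (J : {set 'I_N}) : set (N.-tuple T) :=
  [set z | exists2 A, AA A & forall i, A (tnth z i) <-> i \in J].

(** The points of z may coincide, but the indices in a set shattered by the traces
carry distinct points, since some trace separates any two of them; so the
corresponding set of points has the same cardinality and is shattered by AA. *)
Lemma card_traces T (AA : set (set T)) v N (z : N.-tuple T) :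
  has_vc_dim AA v ->
  (#|[set J : {set 'I_N} | `[< trace_set AA J z >]]%SET| <= N.+1 ^ v)%N.
Proof.
move=> [_ vcAA]; apply: (leq_trans (card_le_shattered _)).
have := card_small_subsets 'I_N v; rewrite card_ord; apply: leq_trans.
apply: subset_leq_card; apply/fintype.subsetP => S /shatteredP shS; rewrite inE.
have tr (U : {set 'I_N}) : U \subset S ->
    exists2 A, AA A & forall i, i \in S -> A (tnth z i) <-> i \in U.
  move=> US; have [J] := shS _ US; rewrite inE => /asboolP[A AAA AJ] JS.
  exists A => // i iS.
  by rewrite AJ -JS inE iS andbT.
have injz : {in S &, injective (tnth z)}.
  move=> i j iS jS zij.
  have iS' : [set i]%SET \subset S by rewrite finset.sub1set.
  have [A AAA Ai] := tr _ iS'.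
  apply/esym/eqP; rewrite -(finset.in_set1 j i); apply/Ai => //; rewrite -zij.
  by apply/Ai; rewrite ?finset.in_set1.
apply: (vcAA (tnth z @` [set` S])).
  apply: (card_eq_trans (inj_card_eq _)).
    by move=> i j; rewrite !inE; exact: injz.
  have -> : [set` S] = (@enum_val _ (mem S)) @` [set: 'I_#|S|].
    apply/seteqP; split => [i /= iS|_ [k _ <-]]; last exact: enum_valP.
    by exists (enum_rank_in iS i) => //; rewrite enum_rankK_in.
  apply: (card_eq_trans (inj_card_eq _)); last by rewrite card_eq_sym; exact: card_II.
  by move=> i j _ _; exact: enum_val_inj.
move=> G GS; pose U := [set i in S | `[< G (tnth z i) >]]%SET.
have US : U \subset S by apply/fintype.subsetP => i; rewrite inE => /andP[].
have [A AAA AU] := tr U US; exists A => //; apply/seteqP; split=> y.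
  by move=> [Ay [i /= iS iy]]; move: Ay; rewrite -iy AU// inE => /andP[_ /asboolP].
move=> Gy; have [i /= iS iy] := GS _ Gy; split; last by exists i.
by rewrite -iy AU// inE iS/=; apply/asboolP; rewrite iy.
Qed.

Local Open Scope ring_scope.

(** * Tuples and independence *)

Definition box T n (B : 'I_n -> set T) : set (n.-tuple T) :=
  [set z | forall i, B i (tnth z i)].

Lemma measurable_box d (T : measurableType d) n (B : 'I_n -> set T) :
  (forall i, measurable (B i)) -> measurable (box B).
Proof.
move=> mB; rewrite (_ : box B =
    \bigcap_(i in [set: 'I_n]) (fun z : n.-tuple T => tnth z i) @^-1` B i).
  apply: fin_bigcap_measurable => // i _.
  by rewrite -[X in measurable X]setTI; apply: measurable_tnth; [|exact: mB].
by apply/seteqP; split => [z h i _|z h i]; [exact: h|exact: (h i I)].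
Qed.

(** Boxes are closed under intersection and generate the product sigma-algebra. *)
Lemma tuple_measure_unique d (T : measurableType d) (R : realType) n
    (m1 m2 : {measure set (n.-tuple T) -> \bar R}) :
  (m1 setT < +oo)%E ->
  (forall B, (forall i, measurable (B i)) -> m1 (box B) = m2 (box B)) ->
  forall A, measurable A -> m1 A = m2 A.
Proof.
move=> m1oo m12 A mA.
pose G := [set A : set (n.-tuple T) |
  exists2 B, (forall i, measurable (B i)) & A = box B].
have boxT : box (fun _ : 'I_n => [set: T]) = setT by apply/seteqP; split.
apply: (measure_unique G (fun=> setT)) => //.
- apply/seteqP; split; last first.
    apply: smallest_sub; first exact: sigma_algebra_measurable.
    by move=> _ [B mB ->]; exact: measurable_box.
  apply: smallest_sub; first exact: smallest_sigma_algebra.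
  rewrite -bigcup_seq/= => _ [i _ [B mB <-]].
  apply: sub_sigma_algebra.
  exists (fun j => if j == i then B else setT); first by move=> j; case: ifP.
  rewrite setTI; apply/seteqP; split => [z /= Bz j|z /(_ i)]; last by rewrite eqxx.
  by case: eqP => // ->.
- move=> _ _ [B mB ->] [C mC ->]; exists (fun i => B i `&` C i).
    by move=> i; exact: measurableI.
  apply/seteqP; split => [z [Bz Cz] i|z BC]; first by split; [exact: Bz|exact: Cz].
  by split => i; have [] := BC i.
- by move=> _; exists (fun=> setT) => //; rewrite boxT.
- by rewrite bigcup_const.
- by move=> _ [B mB ->]; exact: m12.
Qed.

Section weighted_integral.
Local Open Scope ereal_scope.
Context d d' (Omega : measurableType d) (T : measurableType d') (R : realType).
Variables (P : {measure set Omega -> \bar R}) (nu : {measure set T -> \bar R}).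
Variables (Z : Omega -> T) (W : Omega -> R).
Hypotheses (mZ : measurable_fun setT Z) (mW : measurable_fun setT W).
Hypothesis W0 : forall w, (0 <= W w)%R.
Hypothesis nuE : forall B, measurable B ->
  \int[P]_w (\1_B (Z w) * W w)%:E = nu B.

Import HBNNSimple.

(** The integral of f \o Z against the measure with density W only depends on the
image of that measure under Z; by monotone convergence it is enough to know the
image on measurable sets. *)
Lemma ge0_weighted_integral (f : T -> R) :
  measurable_fun setT f -> (forall x, (0 <= f x)%R) ->
  \int[P]_w (f (Z w) * W w)%:E = \int[nu]_x (f x)%:E.
Proof.
move=> mf f0; have mf' : measurable_fun setT (EFin \o f) by exact/measurable_EFinP.
pose f_ := nnsfun_approx measurableT mf'.
have f_cvg x : EFin \o f_^~ x @ \oo --> (f x)%:E.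
  by apply: cvg_nnsfun_approx => // t _; rewrite /= lee_fin.
have f_nd x m n : (m <= n)%N -> (f_ m x <= f_ n x)%R.
  by move=> mn; exact/lefP/nd_nnsfun_approx.
have mfW n : measurable_fun setT (fun w => (f_ n (Z w) * W w)%:E).
  apply/measurable_EFinP; apply: measurable_funM => //.
  exact: measurableT_comp.
transitivity (limn (fun n => \int[P]_w (f_ n (Z w) * W w)%:E)).
  rewrite -monotone_convergence//.
  - apply: eq_integral => w _; apply/esym/cvg_lim => //.
    under eq_fun do rewrite EFinM.
    by rewrite EFinM; apply: cvgeZr => //; exact: f_cvg.
  - by move=> n w _; rewrite lee_fin mulr_ge0.
  - by move=> w _ m n mn; rewrite lee_fin ler_wpM2r// f_nd.
transitivity (limn (fun n => \int[nu]_x (f_ n x)%:E)); last first.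
  rewrite -monotone_convergence//.
  - by apply: eq_integral => x _; apply: cvg_lim => //; exact: f_cvg.
  - by move=> n; apply/measurable_EFinP.
  - by move=> n x _; rewrite lee_fin.
  - by move=> x _ m n mn; rewrite lee_fin f_nd.
congr (limn _); apply/funext => n.
have mk k : measurable (f_ n @^-1` [set k]) by [].
have mkW k : measurable_fun setT
    (fun w => (\1_(f_ n @^-1` [set k]) (Z w) * W w)%:E).
  apply/measurable_EFinP; apply: measurable_funM => //.
  exact: measurableT_comp.
rewrite integralT_nnsfun sintegralE.
transitivity (\int[P]_w (\sum_(k \in range (f_ n))
    (k%:E * (\1_(f_ n @^-1` [set k]) (Z w) * W w)%:E))).
  apply: eq_integral => w _.
  rewrite EFinM fimfunE -fsumEFin// ge0_mule_fsuml//.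
    by apply: eq_fsbigr => k _; rewrite !EFinM muleA.
  by move=> k; rewrite EFinM nnfun_muleindic_ge0.
rewrite ge0_integral_fsum//.
- apply: eq_fsbigr => k; rewrite inE => -[x _ <-].
  rewrite ge0_integralZl_EFin//; first by rewrite nuE.
  by move=> w _; rewrite lee_fin mulr_ge0.
- by move=> k; exact: measurable_funeM.
- move=> k w _; rewrite EFinM muleA mule_ge0 ?nnfun_muleindic_ge0//.
  by rewrite lee_fin.
Qed.

End weighted_integral.

Section independence.
Local Open Scope ereal_scope.
Context (R : realType) d d' (Omega : measurableType d) (T : measurableType d').
Variables (P : probability Omega R) (n : nat) (Z : 'I_n -> Omega -> T).
Hypothesis mZ : forall i, measurable_fun setT (Z i).
Hypothesis iZ : mutually_independent P Z.

Let integral_indic_comp i B : measurable B ->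
  \int[P]_w (\1_B (Z i w))%:E = P (Z i @^-1` B).
Proof.
move=> mB; rewrite -[in RHS](setIT (_ @^-1` _)) -integral_indic//.
by rewrite -[X in measurable X]setTI; exact: mZ.
Qed.

(** For indicators this is the definition of independence.  Indicators are then
replaced by general functions one coordinate at a time: if W is the product of
the other factors, the induction hypothesis says that B |-> E[1_B(Z_k) W] is a
multiple of the law of Z_k, and [ge0_weighted_integral] extends this from
indicators to the k-th function. *)
Lemma independent_integral_prod (f : 'I_n -> T -> R) :
  (forall i, measurable_fun setT (f i)) -> (forall i x, (0 <= f i x)%R) ->
  (forall i, \int[P]_w (f i (Z i w))%:E < +oo) ->
  \int[P]_w (\prod_i f i (Z i w))%:E = \prod_i \int[P]_w (f i (Z i w))%:E.
Proof.
suff main k : (k <= n)%N -> forall f : 'I_n -> T -> R,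
    (forall i, measurable_fun setT (f i)) -> (forall i x, (0 <= f i x)%R) ->
    (forall i, \int[P]_w (f i (Z i w))%:E < +oo) ->
    (forall i : 'I_n, (k <= i)%N -> exists2 B, measurable B & f i = \1_B) ->
    \int[P]_w (\prod_i f i (Z i w))%:E = \prod_i \int[P]_w (f i (Z i w))%:E.
  by move=> mf f0 foo; apply: (main n) => // i; rewrite leqNgt ltn_ord.
elim: k => [_|k IH kn] {}f mf f0 foo fB.
  pose B i := sval (cid2 (fB i isT)).
  have mB i : measurable (B i) by rewrite /B; case: cid2.
  have fE i : f i = \1_(B i) by rewrite /B; case: cid2.
  transitivity (\int[P]_w
      (\1_[set w | forall i, i \in [set: 'I_n]%SET -> B i (Z i w)] w)%:E).
    apply: eq_integral => w _; congr EFin; rewrite indicE.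
    have [wB|wB] := boolP (w \in _).
      rewrite big1// => i _; rewrite fE indicE mem_set//.
      by move: wB; rewrite inE; apply; rewrite inE.
    move: wB; rewrite notin_setE /= => wB.
    have [i Bi] : exists i, ~ B i (Z i w).
      by apply/existsNP => h; apply: wB => i _.
    by rewrite (bigD1 i)//= fE indicE memNset// mul0r.
  have mI : measurable [set w | forall i, i \in [set: 'I_n]%SET -> B i (Z i w)].
    rewrite (_ : [set _ | _] = \bigcap_(i in [set: 'I_n]) (Z i @^-1` B i)).
      apply: fin_bigcap_measurable => // i _.
      by rewrite -[X in measurable X]setTI; exact: mZ.
    by apply/seteqP; split => [w h i _|w h i _]; [apply: h; rewrite inE|exact: (h i I)].
  rewrite integral_indic// setIT; have := iZ [set: 'I_n]%SET mB; rewrite /= => PE.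
  etransitivity; first exact: PE.
  by apply: eq_big => [i|i _]; rewrite ?inE// fE integral_indic_comp.
pose i0 := Ordinal kn.
pose W w := (\prod_(i | i != i0) f i (Z i w))%R.
have mW : measurable_fun setT W.
  rewrite /W; under eq_fun do rewrite -big_filter.
  by apply: measurable_prod => i _; exact: measurableT_comp.
have W0 w : (0 <= W w)%R by exact: prodr_ge0.
pose I i := \int[P]_w (f i (Z i w))%:E.
have I0 i : 0 <= I i by apply: integral_ge0 => w _; rewrite lee_fin.
have Ifin i : I i \is a fin_num by rewrite ge0_fin_numE//; exact: foo.
pose c := (\prod_(i | i != i0) fine (I i))%R.
have c0 : (0 <= c)%R by apply: prodr_ge0 => i _; exact: fine_ge0.
have cE : c%:E = \prod_(i | i != i0) I i.
  rewrite /c; elim/big_rec2 : _ => // i x y _ <-.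
  by rewrite EFinM fineK.
have nuE B : measurable B -> \int[P]_w (\1_B (Z i0 w) * W w)%:E =
    mscale (NngNum c0) (pushforward P (Z i0)) B.
  move=> mB; pose f' i := if i == i0 then \1_B else f i.
  have fi0 : f' i0 = \1_B by rewrite /f' eqxx.
  have := IH (ltnW kn) f'; rewrite (bigD1 i0)//= fi0 integral_indic_comp//.
  rewrite (_ : \prod_(i | i != i0) _ = c%:E); last first.
    rewrite cE; apply: eq_bigr => i /negbTE ii0.
    by apply: eq_integral => w _; rewrite /f' ii0.
  rewrite muleC /mscale /= /pushforward => <-.
  - apply: eq_integral => w _; congr EFin; rewrite (bigD1 i0)//= fi0.
    by congr *%R; apply: eq_bigr => i /negbTE ii0; rewrite /f' ii0.
  - by move=> i; rewrite /f'; case: ifP => // _; exact: measurable_indic.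
  - by move=> i x; rewrite /f'; case: ifP.
  - move=> i; rewrite /f'; case: eqP => [->|_]; last exact: foo.
    rewrite integral_indic_comp//; apply: (le_lt_trans (probability_le1 _ _)).
      by rewrite -[X in measurable X]setTI; exact: mZ.
    by rewrite ltry.
  - move=> i ki; rewrite /f'; case: eqP => [_|/eqP ii0]; first by exists B.
    by apply: fB; rewrite ltn_neqAle ki andbT eq_sym.
transitivity (\int[P]_w (f i0 (Z i0 w) * W w)%:E).
  by apply: eq_integral => w _; rewrite (bigD1 i0).
rewrite (ge0_weighted_integral (mZ i0) mW W0 (nuE (mZ i0)))//.
rewrite ge0_integral_mscale//; last 2 first.
- exact/measurable_EFinP.
- by move=> x _; rewrite lee_fin.
rewrite ge0_integral_pushforward//; last 2 first.
- exact/measurable_EFinP.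
- by move=> x _; rewrite lee_fin.
by rewrite preimage_setT /= cE muleC [RHS](bigD1 i0).
Qed.

End independence.

Lemma integral_same_law (R : realType) d d' (Omega : measurableType d)
    (T : measurableType d') (P : probability Omega R) (Z Z' : Omega -> T)
    (f : T -> R) :
  measurable_fun setT Z -> measurable_fun setT Z' ->
  (forall B, measurable B -> P (Z @^-1` B) = P (Z' @^-1` B)) ->
  measurable_fun setT f -> (forall x, 0 <= f x) ->
  (\int[P]_w (f (Z w))%:E = \int[P]_w (f (Z' w))%:E)%E.
Proof.
move=> mZ mZ' ZZ' mf f0.
have push (Y : Omega -> T) (mY : measurable_fun setT Y) :
    (\int[P]_w (f (Y w))%:E = \int[pushforward P Y]_x (f x)%:E)%E.
  rewrite ge0_integral_pushforward//; first by apply/measurable_EFinP.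
  by move=> x _; rewrite lee_fin.
by rewrite !push//; apply: eq_measure_integral => A mA _; exact: ZZ'.
Qed.

(** * Conditional moment generating functions *)

Section weighted_law.
Local Open Scope ereal_scope.
Context d d' (Omega : measurableType d) (T : measurableType d') (R : realType).
Variables (mu : {measure set Omega -> \bar R}) (Z : Omega -> T) (f : Omega -> R).

(** The image under Z of the measure with density f.  The side conditions are
arguments so that the measure structure can be inferred from the term. *)
Definition weighted_law of measurable_fun setT Z & measurable_fun setT f &
    (forall w, (0 <= f w)%R) : set T -> \bar R :=
  fun A => \int[mu]_(w in Z @^-1` A) (f w)%:E.

Hypotheses (mZ : measurable_fun setT Z) (mf : measurable_fun setT f).
Hypothesis f0 : forall w, (0 <= f w)%R.
Local Notation nu := (weighted_law mZ mf f0).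

Let nu0 : nu set0 = 0.
Proof. by rewrite /weighted_law preimage_set0 integral_set0. Qed.

Let nu_ge0 A : 0 <= nu A.
Proof. by apply: integral_ge0 => w _; rewrite lee_fin. Qed.

Let nu_sigma_additive : semi_sigma_additive nu.
Proof.
move=> F mF tF mUF; rewrite /weighted_law preimage_bigcup.
apply: (semi_sigma_additive_nng_induced (f := EFin \o f)).
- exact/measurable_EFinP.
- by move=> w; rewrite lee_fin.
- by move=> i; rewrite -[X in measurable X]setTI; exact: mZ.
- apply/trivIsetP => i j _ _ ij; rewrite -preimage_setI.
  by move/trivIsetP : tF => /(_ i j I I ij) ->; rewrite preimage_set0.
- by rewrite -preimage_bigcup -[X in measurable X]setTI; exact: mZ.
Qed.

HB.instance Definition _ := isMeasure.Build _ _ _ nu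
  nu0 nu_ge0 nu_sigma_additive.

End weighted_law.

Lemma integral_indicM d (T : measurableType d) (R : realType)
    (mu : {measure set T -> \bar R}) (D : set T) (f : T -> R) :
  (\int[mu]_(x in D) (f x)%:E = \int[mu]_x (\1_D x * f x)%:E)%E.
Proof.
rewrite integral_mkcond; apply: eq_integral => x _.
by rewrite patchE indicE; case: ifP => _; rewrite ?mul1r ?mul0r.
Qed.

Section conditional_mgf.
Local Open Scope ereal_scope.
Context (R : realType) d d' (Omega : measurableType d) (T : measurableType d').
Variables (P : probability Omega R) (X : Omega -> T) (e : Omega -> R) (s2 : R).
Hypotheses (mX : measurable_fun setT X) (sg : cond_sub_gaussian P X e s2).

(** The conditional expectation of the positive variable exp (t e) is almost surely
nonnegative, since its integral over the event where it is negative is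
nonnegative; so clipping it to the interval from 0 to exp (s2 t^2 / 2) changes it
on a null set only.  Bounds that hold everywhere allow it to serve as a
density. *)
Lemma cond_mgf_density (t : R) : exists h : T -> R,
  [/\ measurable_fun setT h, (forall x, 0 <= h x <= expR (s2 * t ^+ 2 / 2))%R &
      forall B, measurable B ->
        \int[P]_w (\1_B (X w) * expR (t * e w))%:E =
        \int[P]_w (\1_B (X w) * h (X w))%:E].
Proof.
have [h [ie mh ih hE] hle] := sg.2 t.
set c := expR _ in hle *.
have mhX : measurable_fun setT (h \o X) by exact: measurableT_comp.
have h_ge0 : {ae P, forall w, (0 <= h (X w))%R}.
  pose A := [set x | (h x < 0)%R].
  have mA : measurable A.
    rewrite (_ : A = h @^-1` `]-oo, 0%R[%classic).
      by rewrite -[X in measurable X]setTI; exact: mh.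
    by apply/seteqP; split => x; rewrite /A /= in_itv.
  have mXA : measurable (X @^-1` A) by rewrite -[X in measurable X]setTI; exact: mX.
  have mhA : measurable_fun (X @^-1` A) (fun w => (h (X w))%:E).
    by apply/measurable_EFinP; exact: measurable_funTS.
  have /(ae_eq_integral_abs P mXA mhA) : \int[P]_(w in X @^-1` A) `|(h (X w))%:E| = 0.
    apply/eqP; rewrite eq_le integral_ge0 ?andbT//.
    rewrite -oppe_ge0 -integral_ge0N//.
    rewrite (_ : \int[_]_(_ in _) _ =
        \int[P]_(w in X @^-1` A) (h (X w))%:E); last first.
      apply: eq_integral => w; rewrite inE => hw.
      by rewrite /= ltr0_norm ?EFinN ?oppeK.
    by rewrite hE//; apply: integral_ge0 => w _; rewrite lee_fin expR_ge0.
  apply: filterS => w hw; rewrite leNgt; apply/negP => hw0.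
  by move: (hw hw0) => [h0]; rewrite h0 ltxx in hw0.
pose k x : R := (Num.min (Num.max (h x) 0) c)%R.
have mk : measurable_fun setT k.
  by apply: measurable_minr => //; exact: measurable_maxr.
have c0 : (0 <= c)%R by exact: expR_ge0.
exists k; split => //.
  by move=> x; rewrite /k le_min le_max lexx orbT c0 ge_min lexx orbT.
move=> B mB.
have mXB : measurable (X @^-1` B) by rewrite -[X in measurable X]setTI; exact: mX.
rewrite -(integral_indicM P (X @^-1` B) (fun w => expR (t * e w))).
rewrite -(integral_indicM P (X @^-1` B) (fun w => k (X w))).
rewrite -hE//; apply: ae_eq_integral => //.
- by apply/measurable_EFinP; exact: measurable_funTS.
- by apply/measurable_EFinP; apply: measurable_funTS; exact: measurableT_comp.
- apply: filterS2 h_ge0 hle => w h0 hc _.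
  by rewrite /k /= max_l// min_l.
Qed.

End conditional_mgf.

Section joint_mgf.
Local Open Scope ereal_scope.
Context (R : realType) d d' (Omega : measurableType d) (T : measurableType d').
Variables (P : probability Omega R) (X : Omega -> T) (Y : Omega -> R).
Variables (n : nat) (Xs : 'I_n -> Omega -> T) (Ys : 'I_n -> Omega -> R).
Hypotheses (mX : measurable_fun setT X) (mY : measurable_fun setT Y).
Hypothesis mXs : forall i, measurable_fun setT (Xs i).
Hypothesis mYs : forall i, measurable_fun setT (Ys i).
Hypothesis iid : iid_copies P (fun w => (X w, Y w)) (fun i w => (Xs i w, Ys i w)).

Definition sample w : n.-tuple T := [tuple Xs i w | i < n].

Lemma measurable_sample : measurable_fun setT sample.
Proof.
apply/measurable_fun_tnthP => i.
by rewrite (_ : _ \o _ = Xs i)//; apply/funext => w; rewrite /= tnth_mktuple.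
Qed.

Let mZ : measurable_fun setT (fun w => (X w, Y w)).
Proof. exact: measurable_fun_pair. Qed.

Let mZs i : measurable_fun setT (fun w => (Xs i w, Ys i w)).
Proof. exact: measurable_fun_pair. Qed.

Let integral_copy i (u : T * R -> R) : measurable_fun setT u ->
  (forall z, (0 <= u z)%R) ->
  \int[P]_w (u (Xs i w, Ys i w))%:E = \int[P]_w (u (X w, Y w))%:E.
Proof.
move=> mu u0; apply: (integral_same_law (mZs i) mZ _ mu u0) => B mB.
exact: iid.2.
Qed.

(** On a box the integrand is a product of functions of the independent pairs
(X_i, Y_i), each distributed as (X, Y). *)
Lemma integral_sample_box (C : 'I_n -> set T) (u : 'I_n -> T * R -> R) :
  (forall i, measurable (C i)) ->
  (forall i, measurable_fun setT (u i)) -> (forall i z, (0 <= u i z)%R) ->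
  (forall i, \int[P]_w (\1_(C i) (X w) * u i (X w, Y w))%:E < +oo) ->
  \int[P]_(w in sample @^-1` box C) (\prod_i u i (Xs i w, Ys i w))%:E =
  \prod_i \int[P]_w (\1_(C i) (X w) * u i (X w, Y w))%:E.
Proof.
move=> mC mu u0 uoo; rewrite integral_indicM.
pose f i (z : T * R) : R := (\1_(C i) z.1 * u i z)%R.
have mf i : measurable_fun setT (f i).
  apply: measurable_funM => //; apply: measurableT_comp => //.
have f0 i z : (0 <= f i z)%R by rewrite mulr_ge0.
transitivity (\int[P]_w (\prod_i f i (Xs i w, Ys i w))%:E).
  apply: eq_integral => w _; congr EFin; rewrite big_split/=; congr *%R.
  rewrite indicE; have [wC|wC] := boolP (w \in _).
    rewrite big1// => i _; rewrite indicE mem_set//.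
    by move: wC; rewrite inE => /(_ i); rewrite tnth_mktuple.
  move: wC; rewrite notin_setE => /existsNP[i]; rewrite tnth_mktuple => Ci.
  by rewrite (bigD1 i)//= indicE memNset// mul0r.
rewrite (independent_integral_prod mZs iid.1 mf f0).
  by apply: eq_bigr => i _; rewrite integral_copy.
by move=> i; rewrite integral_copy//; exact: uoo.
Qed.

Variables (g : T -> R) (s2 : R).
Hypothesis mg : measurable_fun setT g.
Hypothesis sg : cond_sub_gaussian P X (fun w => (Y w - g (X w))%R) s2.

Definition noise i w : R := (Ys i w - g (Xs i w))%R.

(** An inequality between two measures on boxes does not extend to all measurable
sets, but an equality does.  So the exponentials are first replaced by the
conditional expectations given by [cond_mgf_density]: the two measures
B |-> E[1_B(X_1,...,X_n) prod_i ...] agree on boxes, hence everywhere.  The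
pointwise bound on the conditional expectations is used only after that. *)
Lemma joint_mgf_le (t : R) (I : {set 'I_n}) (B : set (n.-tuple T)) :
  measurable B ->
  \int[P]_(w in sample @^-1` B) (expR (t * \sum_(i in I) noise i w))%:E <=
  (expR (s2 * t ^+ 2 / 2 * #|I|%:R))%:E * P (sample @^-1` B).
Proof.
move=> mB; have [h [mh hc hE]] := cond_mgf_density mX sg t.
set c := expR _ in hc.
have h0 x : (0 <= h x)%R by have /andP[] := hc x.
pose a (i : 'I_n) (z : T * R) : R := if i \in I then expR (t * (z.2 - g z.1)) else 1%R.
pose b (i : 'I_n) (z : T * R) : R := if i \in I then h z.1 else 1%R.
have ma i : measurable_fun setT (a i).
  rewrite /a; case: (i \in I) => //; apply: (measurableT_comp (@measurable_expR R)).
  apply: measurable_funM => //; apply: measurable_funB => //.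
  exact: measurableT_comp.
have mb i : measurable_fun setT (b i).
  by rewrite /b; case: (i \in I) => //; exact: measurableT_comp.
have a0 i z : (0 <= a i z)%R by rewrite /a; case: ifP => // _; exact: expR_ge0.
have b0 i z : (0 <= b i z)%R by rewrite /b; case: ifP.
have mprod (u : 'I_n -> T * R -> R) : (forall i, measurable_fun setT (u i)) ->
    measurable_fun setT (fun w => \prod_i u i (Xs i w, Ys i w))%R.
  move=> mu; apply: measurable_prod => i _.
  exact: (measurableT_comp (mu i) (mZs i)).
have prod0 (u : 'I_n -> T * R -> R) : (forall i z, (0 <= u i z)%R) ->
    forall w, (0 <= \prod_i u i (Xs i w, Ys i w))%R.
  by move=> u0 w; exact: prodr_ge0.
have abE i C : measurable C -> \int[P]_w (\1_C (X w) * a i (X w, Y w))%:E =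
    \int[P]_w (\1_C (X w) * b i (X w, Y w))%:E.
  by move=> mC; rewrite /a /b; case: (i \in I) => //; exact: hE.
have boo i C : measurable C -> \int[P]_w (\1_C (X w) * b i (X w, Y w))%:E < +oo.
  move=> mC; apply: (@le_lt_trans _ _ (\int[P]_w (cst (c + 1)%:E w))).
    apply: ge0_le_integral => //.
    - by move=> w _; rewrite lee_fin mulr_ge0.
    - apply/measurable_EFinP; apply: measurable_funM => //.
        exact: measurableT_comp.
      exact: (measurableT_comp (mb i) mZ).
    - move=> w _; rewrite lee_fin.
      have c0 : (0 <= c)%R by exact: expR_ge0.
      rewrite -[leRHS]mul1r ler_pM//.
      rewrite /b; case: ifP => _; last by rewrite lerDr.
      by have /andP[_ /le_trans] := hc (X w); apply; rewrite lerDl.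
  by rewrite integral_cst// [X in _ * X]probability_setT mule1 ltry.
pose nuA : {measure set (n.-tuple T) -> \bar R} :=
  weighted_law P measurable_sample (mprod a ma) (prod0 a a0).
pose nuB : {measure set (n.-tuple T) -> \bar R} :=
  weighted_law P measurable_sample (mprod b mb) (prod0 b b0).
have nuAE C : nuA C =
    \int[P]_(w in sample @^-1` C) (\prod_i a i (Xs i w, Ys i w))%:E by [].
have nuBE C : nuB C =
    \int[P]_(w in sample @^-1` C) (\prod_i b i (Xs i w, Ys i w))%:E by [].
have nuAB : nuA B = nuB B.
  apply: tuple_measure_unique => //.
    rewrite (_ : setT = box (fun _ : 'I_n => [set: T])); last by apply/seteqP; split.
    rewrite nuAE integral_sample_box//; last first.
      by move=> i; rewrite abE//; exact: boo.
    under eq_bigr do rewrite abE//.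
    set y := (X in X < _); suff /andP[] : 0 <= y < +oo by [].
    rewrite /y; apply: (big_ind (fun x => 0 <= x < +oo)) => //.
    - by rewrite lee_fin ler01 ltry.
    - move=> x z /andP[x0 xoo] /andP[z0 zoo].
      by rewrite mule_ge0 ?lte_mul_pinfty ?ge0_fin_numE.
    - move=> i _; rewrite boo// andbT; apply: integral_ge0 => w _.
      by rewrite lee_fin mulr_ge0.
  move=> C mC; rewrite nuAE nuBE !integral_sample_box//.
  - by apply: eq_bigr => i _; exact: abE.
  - by move=> i; exact: boo.
  - by move=> i; rewrite abE//; exact: boo.
have mSB : measurable (sample @^-1` B).
  by rewrite -[X in measurable X]setTI; exact: measurable_sample.
rewrite (_ : \int[_]_(_ in _) _ = nuA B); last first.
  rewrite nuAE; apply: eq_integral => w _; congr EFin.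
  rewrite mulr_sumr expR_sum [RHS](bigID (mem I))/= [X in (_ * X)%R]big1 ?mulr1.
    by apply: eq_bigr => i iI; rewrite /a iI.
  by move=> i /negbTE iI; rewrite /a iI.
rewrite nuAB nuBE -integral_cst//.
apply: ge0_le_integral => //.
- by move=> w _; rewrite lee_fin prodr_ge0.
- by apply/measurable_EFinP; apply: measurable_funTS; exact: (mprod b mb).
- move=> w _; rewrite lee_fin (bigID (mem I))/= [X in (_ * X)%R]big1 ?mulr1.
    rewrite expRM_natr -prodr_const.
    by apply: ler_prod => i iI; rewrite /b iI.
  by move=> i /negbTE iI; rewrite /b iI.
Qed.

End joint_mgf.

(** * Tail of the noise on a fixed index set *)

Section noise_tail.
Local Open Scope ereal_scope.
Context (R : realType) d d' (Omega : measurableType d) (T : measurableType d').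
Variables (P : probability Omega R) (X : Omega -> T) (Y : Omega -> R).
Variables (n : nat) (Xs : 'I_n -> Omega -> T) (Ys : 'I_n -> Omega -> R).
Hypotheses (mX : measurable_fun setT X) (mY : measurable_fun setT Y).
Hypothesis mXs : forall i, measurable_fun setT (Xs i).
Hypothesis mYs : forall i, measurable_fun setT (Ys i).
Hypothesis iid : iid_copies P (fun w => (X w, Y w)) (fun i w => (Xs i w, Ys i w)).
Variables (g : T -> R) (s2 : R).
Hypothesis mg : measurable_fun setT g.
Hypothesis s20 : (0 <= s2)%R.
Hypothesis sg : cond_sub_gaussian P X (fun w => (Y w - g (X w))%R) s2.
Variables (I : {set 'I_n}) (B : set (n.-tuple T)) (L : R).
Hypotheses (mB : measurable B) (L0 : (0 < L)%R).

Local Notation S w := (\sum_(i in I) noise Xs Ys g i w)%R.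
Local Notation SB := (sample Xs @^-1` B).
Local Notation m := (#|I|%:R : R).

Lemma measurable_noise i : measurable_fun setT (noise Xs Ys g i).
Proof. by apply: measurable_funB => //; exact: measurableT_comp. Qed.

Let mS : measurable_fun setT (fun w => S w).
Proof.
under eq_fun do rewrite -big_filter.
by apply: measurable_sum => i; exact: measurable_noise.
Qed.

Let mSB : measurable SB.
Proof. by rewrite -[X in measurable X]setTI; exact: measurable_sample. Qed.

Let measurable_ge (f : Omega -> R) (x : R) : measurable_fun setT f ->
  measurable [set w | (x <= f w)%R].
Proof.
move=> mf; rewrite (_ : [set _ | _] = f @^-1` `[x, +oo[%classic).
  by rewrite -[X in measurable X]setTI; exact: mf.
by apply/seteqP; split => w; rewrite /= in_itv/= andbT.
Qed.

Let measurable_gt (f : Omega -> R) (x : R) : measurable_fun setT f ->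
  measurable [set w | (x < f w)%R].
Proof.
move=> mf; rewrite (_ : [set _ | _] = f @^-1` `]x, +oo[%classic).
  by rewrite -[X in measurable X]setTI; exact: mf.
by apply/seteqP; split => w; rewrite /= in_itv/= andbT.
Qed.

(** Markov's inequality for exp (t S), keeping the event on the covariates. *)
Lemma noise_chernoff (t : R) :
  P (SB `&` [set w | (s2 * t ^+ 2 / 2 * m + L <= t * S w)%R]) <=
  (expR (- L))%:E * P SB.
Proof.
set q := (_ / _ * _)%R; set D := _ `&` _.
have mtS : measurable_fun setT (fun w => t * S w)%R by exact: measurable_funM.
have mD : measurable D by apply: measurableI => //; exact: measurable_ge.
have mE : measurable_fun setT (fun w => (expR (t * S w))%:E).
  by apply/measurable_EFinP; apply: (measurableT_comp (@measurable_expR R)).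
have le : (expR (q + L))%:E * P D <= (expR q)%:E * P SB.
  rewrite -integral_cst//.
  apply: (@le_trans _ _ (\int[P]_(w in D) (expR (t * S w))%:E)).
    apply: ge0_le_integral => //.
    - by move=> w _; rewrite lee_fin expR_ge0.
    - by apply: measurable_funTS.
    - by move=> w [_ /= h]; rewrite lee_fin ler_expR.
  apply: le_trans (joint_mgf_le mX mY mXs mYs iid mg sg t I mB).
  apply: ge0_subset_integral => //.
  - by apply: measurable_funTS.
  - exact: subIsetl.
rewrite (_ : P D = (expR (- (q + L)))%:E * ((expR (q + L))%:E * P D)); last first.
  by rewrite muleA -EFinM mulrC expRxMexpNx_1 mul1e.
rewrite (_ : expR (- L) = expR (- (q + L)) * expR q)%R; last first.
  by rewrite -expRD; congr expR; ring.
by rewrite EFinM -muleA; apply: lee_wpmul2l => //; rewrite lee_fin expR_ge0.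
Qed.

(** The sign eta treats both tails at once.  The optimal parameter in
[noise_chernoff] is t = eta sqrt (2 L / (m s2)).  Since s2 may vanish, it is taken
with s2 + 1 / (k + 1) in place of s2, and k tends to infinity by continuity from
below. *)
Lemma noise_tail_onesided (eta : R) : (eta ^+ 2 = 1)%R ->
  P (SB `&` [set w | (Num.sqrt (2 * m * s2 * L) < eta * S w)%R]) <=
  (expR (- L))%:E * P SB.
Proof.
move=> eta2; set D := _ `&` _.
have metaS : measurable_fun setT (fun w => eta * S w)%R by exact: measurable_funM.
have mD : measurable D by apply: measurableI => //; exact: measurable_gt.
(* t is not defined when I is empty, but then the noise is 0 *)
have [I0|In0] := eqVneq I finset.set0.
  rewrite (_ : D = set0) ?measure0 ?mule_ge0 ?lee_fin ?expR_ge0//.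
  apply/seteqP; split => // w [_] /=.
  by rewrite I0 big_set0 cards0 mulr0 !(mul0r, mulr0) sqrtr0 ltxx.
have m0 : (0 < m)%R by rewrite ltr0n card_gt0.
pose a k : R := (s2 + k.+1%:R^-1)%R.
have a0 k : (0 < a k)%R by rewrite /a ltr_wpDl// invr_gt0 ltr0n.
pose F k := SB `&` [set w | (Num.sqrt (2 * m * a k * L) <= eta * S w)%R].
have mF k : measurable (F k) by apply: measurableI => //; exact: measurable_ge.
have mUF : measurable (\bigcup_k F k) by exact: bigcup_measurable.
have Fle k : P (F k) <= (expR (- L))%:E * P SB.
  pose r := Num.sqrt (2 * L / (m * a k)).
  have r2 : (r ^+ 2 = 2 * L / (m * a k))%R.
    by rewrite sqr_sqrtr// divr_ge0// mulr_ge0// ltW.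
  have t2 : ((eta * r) ^+ 2 = 2 * L / (m * a k))%R by rewrite exprMn eta2 mul1r.
  apply: le_trans (noise_chernoff (eta * r)); apply: le_measure; rewrite ?inE//.
    apply: measurableI => //; apply: measurable_ge; exact: measurable_funM.
  move=> w [Bw /= Sw]; split => //=; rewrite t2.
  have -> : (eta * r * S w = r * (eta * S w))%R by ring.
  have : (r * Num.sqrt (2 * m * a k * L) <= r * (eta * S w))%R.
    by rewrite ler_wpM2l// sqrtr_ge0.
  apply: le_trans.
  have -> : (r * Num.sqrt (2 * m * a k * L) = L + L)%R.
    rewrite -sqrtrM; last by rewrite divr_ge0// mulr_ge0// ltW.
    have -> : (2 * L / (m * a k) * (2 * m * a k * L) = (L + L) ^+ 2)%R.
      by field; rewrite !gt_eqF.
    by rewrite sqrtr_sqr ger0_norm// addr_ge0// ltW.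
  rewrite lerD2r.
  have -> : (s2 * (2 * L / (m * a k)) / 2 * m = s2 / a k * L)%R.
    by field; rewrite !gt_eqF.
  rewrite -[leRHS]mul1r; apply: ler_wpM2r; first exact: ltW.
  by rewrite ler_pdivrMr// mul1r /a lerDl invr_ge0.
have ndF : nondecreasing_seq F.
  move=> i j ij; apply/subsetPset => w [Bw /= h]; split => //=; apply: le_trans h.
  apply: ler_wsqrtr; apply: ler_wpM2r; first exact: ltW.
  by apply: ler_wpM2l; rewrite ?mulr_ge0// /a lerD2l lef_pV2 ?posrE// ler_nat.
apply: (@le_trans _ _ (P (\bigcup_k F k))).
  apply: le_measure; rewrite ?inE//.
  move=> w [Bw /= Sw].
  pose q := (2 * m * s2 * L)%R.
  have q0 : (0 <= q)%R by rewrite !mulr_ge0// ltW.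
  have x0 : (0 < eta * S w)%R by apply: le_lt_trans Sw; exact: sqrtr_ge0.
  have qx : (q < (eta * S w) ^+ 2)%R.
    by rewrite -(sqr_sqrtr q0) ltr_pXn2r// nnegrE ?sqrtr_ge0// ltW.
  have dx : (0 < (eta * S w) ^+ 2 - q)%R by rewrite subr_gt0.
  pose k := Num.truncn (2 * m * L / ((eta * S w) ^+ 2 - q)).
  exists k => //; split => //=.
  rewrite -[leRHS](ger0_norm (ltW x0)) -sqrtr_sqr; apply: ler_wsqrtr.
  have -> : (2 * m * a k * L = q + 2 * m * L / k.+1%:R)%R.
    by rewrite /a /q; ring.
  rewrite -lerBrDl ler_pdivrMr// [leRHS]mulrC -ler_pdivrMr//.
  exact/ltW/truncnS_gt.
have cvgF := nondecreasing_cvg_mu (mu := P) mF mUF ndF.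
rewrite -(cvg_lim _ cvgF)//; apply: lime_le.
  by apply/cvg_ex; eexists; exact: cvgF.
exact: nearW.
Qed.

Lemma noise_tail :
  P (SB `&` [set w | (Num.sqrt (2 * m * s2 * L) < `|S w|)%R]) <=
  (2 * expR (- L))%:E * P SB.
Proof.
pose D eta := SB `&` [set w | (Num.sqrt (2 * m * s2 * L) < eta * S w)%R].
have mD eta : measurable (D eta).
  by apply: measurableI => //; apply: measurable_gt; exact: measurable_funM.
apply: (@le_trans _ _ (P (D 1%R `|` D (-1)%R))).
  apply: le_measure; rewrite ?inE.
  - apply: measurableI => //; apply: measurable_gt; exact: measurableT_comp.
  - by apply: measurableU.
  move=> w [Bw /=]; rewrite /D ltr_normr => /orP[h|h]; [left|right]; split => //=.
    by rewrite mul1r.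
  by rewrite mulN1r.
apply: (le_trans (measureU2 _ (mD _) (mD _))).
rewrite (_ : 2 * expR (- L) = expR (- L) + expR (- L))%R; last by ring.
rewrite EFinD ge0_muleDl ?lee_fin ?expR_ge0//.
by apply: leeD; apply: noise_tail_onesided; ring.
Qed.

End noise_tail.

(** * Union bound over the traces *)

Section traces.
Local Open Scope ereal_scope.

Lemma measure_bigsetU_le d (T : measurableType d) (R : realType)
    (mu : {measure set T -> \bar R}) (I : finType) (p : pred I) (F : I -> set T) :
  (forall i, measurable (F i)) ->
  mu (\big[setU/set0]_(i | p i) F i) <= \sum_(i | p i) mu (F i).
Proof.
move=> mF; suff [] : measurable (\big[setU/set0]_(i | p i) F i) /\
  mu (\big[setU/set0]_(i | p i) F i) <= \sum_(i | p i) mu (F i) by [].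
elim/big_rec2 : _ => [|i y A _ [mA le]]; first by rewrite measure0.
split; first exact: measurableU.
by apply: (le_trans (measureU2 _ _ _)) => //; exact: leeD2l.
Qed.

(** The sum of the measures is the expected number of the sets that contain a
random point. *)
Lemma sum_measure_le_mult d (T : measurableType d) (R : realType)
    (mu : probability T R) (I : finType) (F : I -> set T) (K : nat) :
  (forall i, measurable (F i)) ->
  (forall x, (#|[set i | x \in F i]%SET| <= K)%N) ->
  \sum_i mu (F i) <= K%:R%:E.
Proof.
move=> mF FK.
rewrite (eq_bigr (fun i => \int[mu]_x (\1_(F i) x)%:E)); last first.
  by move=> i _; rewrite integral_indic// setIT.
rewrite -ge0_integral_sum//; last by move=> i; apply/measurable_EFinP.
apply: (@le_trans _ _ (\int[mu]_x (cst K%:R%:E x))).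
  apply: ge0_le_integral => //.
  - by move=> x _; apply: sume_ge0 => i _; rewrite lee_fin.
  - by apply: emeasurable_sum => i; apply/measurable_EFinP.
  - move=> x _; rewrite sumEFin lee_fin.
    under eq_bigr do rewrite indicE.
    rewrite -natr_sum ler_nat; apply: leq_trans (FK x).
    rewrite -sum1_card big_mkcond [leqRHS]big_mkcond; apply: leq_sum => i _.
    by rewrite inE; case: ifP => // ->.
by rewrite integral_cst// [X in _ * X]probability_setT mule1.
Qed.

Variables (R : realType) (d : measure_display) (T : measurableType d).
Variables (AA : set (set T)) (v : nat).
Hypotheses (vcAA : has_vc_dim AA v) (mAA : @measurable_class R _ T AA).

(** B1 J and B2 J approximate the event that J is a trace from inside and outside
up to a null set.  A point lies in at most (N + 1)^v of the B1 J, because these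
are contained in the events themselves, and B1 J and B2 J have the same
measure. *)
Lemma trace_approx N (mu : probability (N.-tuple T) R) :
  exists B1 B2 : {set 'I_N} -> set (N.-tuple T),
    (forall J, [/\ measurable (B1 J), measurable (B2 J),
      B1 J `<=` trace_set AA J, trace_set AA J `<=` B2 J &
      mu (B1 J) = mu (B2 J)]) /\
    \sum_J mu (B2 J) <= (N.+1 ^ v)%:R%:E.
Proof.
have /choice[B1 /choice[B2 B12]] := fun J : {set 'I_N} => mAA J mu.
have B12E J : mu (B1 J) = mu (B2 J).
  have [mB1 mB2 B1s B2s mu0] := B12 J.
  have -> : B2 J = B1 J `|` (B2 J `\` B1 J).
    by rewrite setDUK//; exact: subset_trans B2s.
  apply/eqP; rewrite eq_le; apply/andP; split.
    by apply: le_measure; rewrite ?inE//; apply: measurableU => //; exact: measurableD.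
  apply: (le_trans (measureU2 _ _ _)) => //; first exact: measurableD.
  by rewrite [X in _ + X]mu0 adde0.
exists B1, B2; split.
  by move=> J; have [mB1 mB2 B1s B2s _] := B12 J; split.
under eq_bigr do rewrite -B12E.
apply: sum_measure_le_mult => [J|z]; first by have [] := B12 J.
apply: leq_trans (card_traces z vcAA); apply: subset_leq_card.
apply/fintype.subsetP => J; rewrite !inE => zB.
by have [_ _ B1s _ _] := B12 J; exact: B1s.
Qed.

End traces.

Section noise_uniform.
Local Open Scope ereal_scope.
Context (R : realType) d d' (Omega : measurableType d) (T : measurableType d').
Variables (P : probability Omega R) (X : Omega -> T) (Y : Omega -> R).
Variables (n : nat) (Xs : 'I_n -> Omega -> T) (Ys : 'I_n -> Omega -> R).
Hypotheses (mX : measurable_fun setT X) (mY : measurable_fun setT Y).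
Hypothesis mXs : forall i, measurable_fun setT (Xs i).
Hypothesis mYs : forall i, measurable_fun setT (Ys i).
Hypothesis iid : iid_copies P (fun w => (X w, Y w)) (fun i w => (Xs i w, Ys i w)).
Variables (g : T -> R) (s2 : R).
Hypothesis mg : measurable_fun setT g.
Hypothesis s20 : (0 <= s2)%R.
Hypothesis sg : cond_sub_gaussian P X (fun w => (Y w - g (X w))%R) s2.
Variables (AA : set (set T)) (v : nat) (L : R).
Hypotheses (vcAA : has_vc_dim AA v) (mAA : @measurable_class R _ T AA).
Hypothesis L0 : (0 < L)%R.

Definition hits (A : set T) w : {set 'I_n} := [set i | `[< A (Xs i w) >]]%SET.

(** Union bound over all index sets J of the event that J is a trace and the noise
summed over J is large; by [noise_tail] each costs 2 exp (- L) times the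
probability of the first condition, and those probabilities add up to at most
(n + 1)^v. *)
Lemma noise_uniform : exists G : set Omega,
  [/\ measurable G, P G <= (2 * expR (- L) * (n.+1 ^ v)%:R)%:E &
      forall w, ~ G w -> forall A, AA A ->
        (`|\sum_(i in hits A w) noise Xs Ys g i w| <=
          Num.sqrt (2 * #|hits A w|%:R * s2 * L))%R].
Proof.
pose smix := isMeasurableFun.Build _ _ _ _ _ (measurable_sample mXs).
pose sm : {mfun Omega >-> n.-tuple T} := HB.pack (sample Xs) smix.
have [B1 [B2 [B12 sumB]]] := trace_approx vcAA mAA (distribution P sm).
pose F J := (sample Xs @^-1` B2 J) `&`
  [set w | (Num.sqrt (2 * #|J|%:R * s2 * L) < `|\sum_(i in J) noise Xs Ys g i w|)%R].
have mB2 J : measurable (B2 J) by have [] := B12 J.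
have mF J : measurable (F J).
  apply: measurableI.
    by rewrite -[X in measurable X]setTI; exact: measurable_sample.
  rewrite (_ : [set _ | _] = (fun w => `|\sum_(i in J) noise Xs Ys g i w|)%R @^-1`
    `]Num.sqrt (2 * #|J|%:R * s2 * L), +oo[%classic).
    rewrite -[X in measurable X]setTI; apply: measurableT_comp => //.
    under eq_fun do rewrite -big_filter.
    by apply: measurable_sum => i; exact: measurable_noise.
  by apply/seteqP; split => w; rewrite /= in_itv/= andbT.
exists (\big[setU/set0]_J F J); split.
- exact: bigsetU_measurable.
- apply: (le_trans (measure_bigsetU_le _ _ mF)).
  apply: (@le_trans _ _ (\sum_J (2 * expR (- L))%:E * distribution P sm (B2 J))).
    apply: lee_sum => J _.
    exact: (noise_tail mX mY mXs mYs iid mg s20 sg J (mB2 J) L0).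
  rewrite -ge0_sume_distrr// [leRHS]EFinM; apply: lee_wpmul2l => //.
- move=> w Gw A AAA; rewrite leNgt; apply/negP => h; apply: Gw.
  rewrite -bigcup_seq/=; exists (hits A w); first by rewrite /= mem_index_enum.
  split => //; have [_ _ _ + _] := B12 (hits A w); apply.
  by exists A => // i; rewrite tnth_mktuple inE; split => /asboolP.
Qed.

End noise_uniform.

(** * Exchanges between two samples *)

Section swaps.
Variables (n : nat).
Implicit Types (s : {ffun 'I_n -> bool}) (J : {set 'I_(n + n)}).

(** The first n indices stand for one sample and the last n for the other; s tells
which pairs of corresponding points are exchanged. *)
Definition swap s (k : 'I_(n + n)) : 'I_(n + n) :=
  match fintype.split k with
  | inl i => if s i then rshift n i else lshift n i
  | inr i => if s i then lshift n i else rshift n i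
  end.

Lemma swap_lshift s i : swap s (lshift n i) = if s i then rshift n i else lshift n i.
Proof. by rewrite /swap -[lshift n i]/(unsplit (inl i)) unsplitK. Qed.

Lemma swap_rshift s i : swap s (rshift n i) = if s i then lshift n i else rshift n i.
Proof. by rewrite /swap -[rshift n i]/(unsplit (inr i)) unsplitK. Qed.

Lemma swapK s : involutive (swap s).
Proof.
move=> k; case: (split_ordP k) => i ->;
  rewrite ?swap_lshift ?swap_rshift; case: ifP => si;
  by rewrite ?swap_lshift ?swap_rshift si.
Qed.

Definition swap_set s J : {set 'I_(n + n)} := [set k | swap s k \in J]%SET.

Lemma swap_setK s : involutive (swap_set s).
Proof. by move=> J; apply/setP => k; rewrite !inE swapK. Qed.

Definition left_count J := (\sum_(i < n) (lshift n i \in J))%N.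
Definition right_count J := (\sum_(i < n) (rshift n i \in J))%N.

Lemma left_count_swap s J : left_count (swap_set s J) =
  (\sum_(i < n) ((if s i then rshift n i else lshift n i) \in J))%N.
Proof. by apply: eq_bigr => i _; rewrite inE swap_lshift. Qed.

Lemma total_count_swap s J :
  (left_count (swap_set s J) + right_count (swap_set s J) =
   left_count J + right_count J)%N.
Proof.
rewrite /left_count /right_count -!big_split/=; apply: eq_bigr => i _.
by rewrite !inE swap_lshift swap_rshift; case: ifP => // _; rewrite addnC.
Qed.

Context {R : realType}.

(** The second sample has enough points for an exponential estimate, and the share
of the first is so small that the discount e^(-4) per point of the first sample
in [card_unbalanced_swaps] hardly matters. *)
Definition unbalanced (l : R) J :=
  (2 * l <= (right_count J)%:R) && (255 * left_count J < right_count J)%N.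

Lemma expR1_ge2 : 2 <= expR 1 :> R.
Proof. by have := @expR_ge1Dx R 1; rewrite (_ : 1 + 1 = 2 :> R). Qed.

(** Chernoff bound for a uniformly random exchange.  Let m be the number of indices
in J and q = e^(-4).  The mean of q^(left count) factors over the n pairs, and a
pair with j indices in J contributes at most ((1 + q) / 2)^j.  For an unbalanced
set the left count is below m / 256, so that q^(left count) >= e^(- m / 64).
Since (1 + q) / 2 <= e^(- 1/2 - 1/64), the fraction of unbalanced exchanges is at
most e^(- m / 2), and m >= 2 l. *)
Lemma card_unbalanced_swaps (l : R) J :
  #|[set s | unbalanced l (swap_set s J)]%SET|%:R <= 2 ^+ n * expR (- l).
Proof.
set U := [set s | _]%SET.
have [->|[s0 s0U]] := set_0Vmem U; first by rewrite cards0 mulr_ge0// expR_ge0.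
pose m := (left_count J + right_count J)%N.
have lm : 2 * l <= m%:R.
  move: s0U; rewrite inE => /andP[h _]; apply: (le_trans h).
  by rewrite ler_nat /m -(total_count_swap s0 J) leq_addl.
pose q : R := expR (- 4).
have q0 : 0 < q by exact: expR_gt0.
have q16 : q <= 16^-1.
  rewrite /q expRN lef_pV2 ?posrE ?expR_gt0//.
  rewrite (_ : 4 = 4%:R * 1); last by rewrite mulr1.
  rewrite expRM_natl (_ : 16 = 2 ^+ 4); last by ring.
  by rewrite lerXn2r ?nnegrE ?expR_ge0 ?expR1_ge2.
pose r : R := (1 + q) / 2.
have r0 : 0 < r by rewrite /r; lra.
have sumE : \sum_(s : {ffun 'I_n -> bool}) q ^+ left_count (swap_set s J) <=
    2 ^+ n * r ^+ m.
  rewrite (eq_bigr (fun s : {ffun 'I_n -> bool} =>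
     \prod_(i < n) q ^+ ((if s i then rshift n i else lshift n i) \in J))); last first.
    by move=> s _; rewrite left_count_swap expr_sum.
  rewrite -(bigA_distr_bigA (fun (i : 'I_n) (b : bool) =>
     q ^+ ((if b then rshift n i else lshift n i) \in J))).
  have -> : 2 ^+ n * r ^+ m =
      \prod_(i < n) (2 * r ^+ ((lshift n i \in J) + (rshift n i \in J))%N).
    rewrite big_split/= prodr_const card_ord -expr_sum big_split/=.
    by congr (_ * r ^+ _).
  apply: ler_prod => i _; rewrite big_bool/=.
  case: (lshift n i \in J); case: (rshift n i \in J);
    rewrite /= ?expr0 ?expr1 ?addr_ge0 ?(ltW q0)//=.
  - by rewrite /r; nra.
  - by rewrite /r; lra.
  - by rewrite /r; lra.
  - by rewrite mulr1.
have count : #|U|%:R * expR (- (m%:R / 64)) <= 2 ^+ n * r ^+ m.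
  apply: le_trans sumE.
  rewrite (bigID (fun s => s \in U))/= -[leLHS]addr0; apply: lerD; last first.
    by apply: sumr_ge0 => s _; rewrite exprn_ge0// ltW.
  rewrite mulr_natl -sumr_const; apply: ler_sum => s.
  rewrite inE => /andP[_ h].
  rewrite /q -expRM_natl ler_expR mulrN lerN2.
  rewrite ler_pdivlMr//.
  rewrite /m -(total_count_swap s J).
  move: h; rewrite -(ltr_nat R) natrM natrD.
  by set a := (left_count _)%:R; set b := (right_count _)%:R; lra.
have rle : r <= expR (- (1 / 2 + 64^-1)).
  apply: (@le_trans _ _ ((95 / 128) ^+ 2)).
    by rewrite /r; move: q16; lra.
  rewrite (_ : - (1 / 2 + 64^-1) = 2%:R * (- (33 / 128))); last by field.
  have e95 : 95 / 128 <= expR (- (33 / 128)) :> R.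
    by apply: le_trans (expR_ge1Dx _); lra.
  by rewrite expRM_natl lerXn2r ?nnegrE ?expR_ge0//; lra.
have : #|U|%:R * expR (- (m%:R / 64)) <= 2 ^+ n * expR (- (1 / 2 + 64^-1)) ^+ m :> R.
  apply: (le_trans count); rewrite ler_pM2l ?exprn_gt0//.
  by rewrite lerXn2r ?nnegrE ?expR_ge0 ?(ltW r0).
rewrite -expRM_natl.
have -> : m%:R * - (1 / 2 + 64^-1) = - (m%:R / 2) + - (m%:R / 64) :> R by field.
rewrite expRD mulrA ler_pM2r ?expR_gt0// => /le_trans; apply.
rewrite ler_pM2l ?exprn_gt0// ler_expR lerN2 ler_pdivlMr//.
by rewrite mulrC.
Qed.

End swaps.

(** * The second sample *)

Section ghost_sample.
Local Open Scope ereal_scope.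
Context (R : realType) d d' (Omega : measurableType d) (T : measurableType d').
Variables (P : probability Omega R) (X : Omega -> T).
Variables (n : nat) (Xs : 'I_n -> Omega -> T).
Hypothesis mXs : forall i, measurable_fun setT (Xs i).
Hypothesis iXs : mutually_independent P Xs.
Hypothesis lXs : forall i B, measurable B -> P (Xs i @^-1` B) = P (X @^-1` B).

(** The product space carries two independent copies of the sample, one for each
coordinate. *)
Definition ghost (p : Omega * Omega) : (n + n).-tuple T :=
  [tuple match fintype.split k with
         | inl i => Xs i p.1 | inr i => Xs i p.2 end | k < n + n].

Lemma ghost_lshift p i : tnth (ghost p) (lshift n i) = Xs i p.1.
Proof. by rewrite tnth_mktuple -[lshift n i]/(unsplit (inl i)) unsplitK. Qed.

Lemma ghost_rshift p i : tnth (ghost p) (rshift n i) = Xs i p.2.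
Proof. by rewrite tnth_mktuple -[rshift n i]/(unsplit (inr i)) unsplitK. Qed.

Lemma measurable_ghost : measurable_fun setT ghost.
Proof.
apply/measurable_fun_tnthP => k; case: (split_ordP k) => i ->.
  rewrite (_ : _ \o _ = Xs i \o fst); last first.
    by apply/funext => p; rewrite /= ghost_lshift.
  exact: measurableT_comp.
rewrite (_ : _ \o _ = Xs i \o snd); last first.
  by apply/funext => p; rewrite /= ghost_rshift.
exact: measurableT_comp.
Qed.

Lemma ghost_box (B : 'I_(n + n) -> set T) : (forall k, measurable (B k)) ->
  (P \x P) (ghost @^-1` box B) = \prod_k P (X @^-1` B k).
Proof.
move=> mB.
pose E (C : 'I_n -> set T) := [set w | forall i, i \in [set: 'I_n]%SET -> C i (Xs i w)].
have mE C : (forall i, measurable (C i)) -> measurable (E C).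
  move=> mC; rewrite (_ : E C = \bigcap_(i in [set: 'I_n]) (Xs i @^-1` C i)).
    apply: fin_bigcap_measurable => // i _.
    by rewrite -[X in measurable X]setTI; exact: mXs.
  by apply/seteqP; split => [w h i _|w h i _]; [apply: h; rewrite inE|exact: (h i I)].
have PE C : (forall i, measurable (C i)) -> P (E C) = \prod_i P (X @^-1` C i).
  move=> mC; etransitivity; first exact: (iXs [set: 'I_n]%SET mC).
  by apply: eq_big => [i|i _]; rewrite ?inE// lXs.
rewrite (_ : ghost @^-1` box B =
    E (fun i => B (lshift n i)) `*` E (fun i => B (rshift n i))); last first.
  apply/seteqP; split => [p Bp|p [Bl Br] k].
    by split => i _ /=; rewrite -?ghost_lshift -?ghost_rshift; exact: Bp.
  by case: (split_ordP k) => i ->; rewrite ?ghost_lshift ?ghost_rshift;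
    [apply: Bl|apply: Br]; rewrite inE.
rewrite big_split_ord/= -!PE//.
by apply: product_measure1E; exact: mE.
Qed.

(** By [ghost_box] the law of the 2n points gives the same value to a box and to
the box with permuted sides. *)
Lemma ghost_swap_invariant (s : {ffun 'I_n -> bool}) (B : set ((n + n).-tuple T)) :
  measurable B ->
  (P \x P) (ghost @^-1` [set z | B [tuple tnth z (swap s k) | k < n + n]]) =
  (P \x P) (ghost @^-1` B).
Proof.
move=> mB; pose sw (z : (n + n).-tuple T) := [tuple tnth z (swap s k) | k < n + n].
have msw : measurable_fun setT (sw \o ghost).
  apply/measurable_fun_tnthP => k.
  rewrite (_ : _ \o _ = (fun z => tnth z (swap s k)) \o ghost); last first.
    by apply/funext => p; rewrite /= tnth_mktuple.
  by apply: measurableT_comp; [exact: measurable_tnth|exact: measurable_ghost].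
pose gmix := isMeasurableFun.Build _ _ _ _ _ measurable_ghost.
pose gm : {mfun _ >-> _} := HB.pack ghost gmix.
pose smix := isMeasurableFun.Build _ _ _ _ _ msw.
pose sm : {mfun _ >-> _} := HB.pack (sw \o ghost) smix.
suff : distribution (P \x P) sm B = distribution (P \x P) gm B by [].
apply: tuple_measure_unique => //.
  by rewrite [X in X < _]probability_setT ltry.
move=> C mC.
transitivity ((P \x P) ((sw \o ghost) @^-1` box C)); first by [].
transitivity ((P \x P) (ghost @^-1` box C)); last by [].
rewrite (_ : (sw \o ghost) @^-1` box C =
    ghost @^-1` box (fun k => C (swap s k))); last first.
  apply/seteqP; split => p /= h k.
    by have := h (swap s k); rewrite tnth_mktuple swapK.
  by rewrite tnth_mktuple; have := h (swap s k); rewrite swapK.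
rewrite !ghost_box//.
by rewrite [RHS](reindex_inj (inv_inj (swapK s))).
Qed.

Variables (AA : set (set T)) (v : nat) (l : R).
Hypotheses (vcAA : has_vc_dim AA v) (mAA : @measurable_class R _ T AA).

(** Let M J be the probability that J is a trace of the 2n points.  By invariance
M does not increase under any exchange, so the sum of M over the unbalanced sets
is at most its average over all exchanges s of the sum of M over the J that s
makes unbalanced, that is, at most exp (- l) times the sum of all M J. *)
Lemma ghost_unbalanced : exists D : set (Omega * Omega),
  [/\ measurable D, (P \x P) D <= (expR (- l) * ((n + n).+1 ^ v)%:R)%:E &
      forall p J, unbalanced l J -> trace_set AA J (ghost p) -> D p].
Proof.
pose gmix := isMeasurableFun.Build _ _ _ _ _ measurable_ghost.
pose gm : {mfun _ >-> _} := HB.pack ghost gmix.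
have [B1 [B2 [B12 sumB]]] := trace_approx vcAA mAA (distribution (P \x P) gm).
pose mu := distribution (P \x P) gm.
have mB1 J : measurable (B1 J) by have [] := B12 J.
have mB2 J : measurable (B2 J) by have [] := B12 J.
pose M J := fine (mu (B2 J)).
have ME J : mu (B2 J) = (M J)%:E.
  by rewrite fineK// fin_num_measure.
have M0 J : (0 <= M J)%R by rewrite fine_ge0.
(* the inner approximation of one event is carried into the outer one of the other *)
have MS s J : (M (swap_set s J) <= M J)%R.
  rewrite -lee_fin -!ME.
  have [_ _ _ _ e] := B12 (swap_set s J).
  have -> : mu (B2 (swap_set s J)) = (P \x P) (ghost @^-1` B1 (swap_set s J)).
    exact: esym e.
  rewrite -(ghost_swap_invariant s)//.
  apply: le_measure; rewrite ?inE.
  - rewrite -[X in measurable X]setTI.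
    pose sw (z : (n + n).-tuple T) := [tuple tnth z (swap s k) | k < n + n].
    apply: (measurableT_comp (f := sw) _ measurable_ghost) => //.
    apply/measurable_fun_tnthP => k.
    rewrite (_ : _ \o _ = (fun z => tnth z (swap s k))); first exact: measurable_tnth.
    by apply/funext => p; rewrite /= tnth_mktuple.
  - by rewrite -[X in measurable X]setTI; exact: measurable_ghost.
  - move=> p /= h; have [_ _ B1s B2s _] := B12 J; apply: B2s.
    have [_ _ B1s' _ _] := B12 (swap_set s J).
    have [A AAA AE] := B1s' _ h; exists A => // k.
    have := AE (swap s k); rewrite tnth_mktuple swapK inE swapK.
    exact.
have sumM : (\sum_J M J <= ((n + n).+1 ^ v)%:R)%R.
  by rewrite -lee_fin -sumEFin; under eq_bigr do rewrite -ME.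
have bound : (\sum_(J | unbalanced l J) M J <= expR (- l) * ((n + n).+1 ^ v)%:R)%R.
  have n2 : (0 < 2 ^+ n :> R)%R by rewrite exprn_gt0.
  rewrite -(ler_pM2l n2).
  apply: (@le_trans _ _ (\sum_(s : {ffun 'I_n -> bool})
      \sum_(J | unbalanced l J) M J)%R).
    by rewrite sumr_const -[leRHS]mulr_natl card_ffun card_bool card_ord natrX.
  apply: (@le_trans _ _ (\sum_(s : {ffun 'I_n -> bool})
      \sum_(J | unbalanced l (swap_set s J)) M J)%R).
    apply: ler_sum => s _.
    by rewrite (reindex_inj (inv_inj (@swap_setK _ s)))/=; apply: ler_sum.
  rewrite (exchange_big_dep xpredT)//=.
  apply: (@le_trans _ _ (\sum_J 2 ^+ n * expR (- l) * M J)%R).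
    apply: ler_sum => J _; rewrite sumr_const -[leLHS]mulr_natl.
    apply: ler_wpM2r => //; apply: le_trans (card_unbalanced_swaps l J).
    by rewrite ler_nat; apply: subset_leq_card; apply/fintype.subsetP => s; rewrite inE.
  by rewrite -mulr_sumr -mulrA ler_pM2l// ler_wpM2l// expR_ge0.
exists (\big[setU/set0]_(J | unbalanced l J) (ghost @^-1` B2 J)); split.
- apply: bigsetU_measurable => J _.
  by rewrite -[X in measurable X]setTI; exact: measurable_ghost.
- apply: (le_trans (measure_bigsetU_le _ _ _)).
    by move=> J; rewrite -[X in measurable X]setTI; exact: measurable_ghost.
  apply: (@le_trans _ _ (\sum_(J | unbalanced l J) (M J)%:E)).
    by apply: lee_sum => J _; rewrite -ME.
  by rewrite sumEFin lee_fin.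
- move=> p J uJ AJ; rewrite (bigD1 J)//=; left.
  by have [_ _ _ B2s _] := B12 J; exact: B2s.
Qed.

End ghost_sample.

(** * Lower bound on the number of points in a cell *)

Section mass_bound.
Local Open Scope ereal_scope.
Context (R : realType) d d' (Omega : measurableType d) (T : measurableType d').
Variables (P : probability Omega R) (X : Omega -> T).
Variables (n : nat) (Xs : 'I_n -> Omega -> T).
Hypothesis mX : measurable_fun setT X.
Hypothesis mXs : forall i, measurable_fun setT (Xs i).
Hypothesis iXs : mutually_independent P Xs.
Hypothesis lXs : forall i B, measurable B -> P (Xs i @^-1` B) = P (X @^-1` B).

Definition prob_in (A : set T) : R := fine (P (X @^-1` A)).

Lemma card_hits (A : set T) w :
  #|hits Xs A w|%:R = (\sum_i \1_A (Xs i w))%R :> R.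
Proof.
rewrite -sum1_card big_mkcond natr_sum; apply: eq_bigr => i _.
rewrite inE indicE; have [h|h] := pselect (A (Xs i w)).
  by rewrite asboolT// mem_set.
by rewrite asboolF// memNset.
Qed.

Lemma measurable_card_hits (A : set T) : measurable A ->
  measurable_fun setT (fun w => #|hits Xs A w|%:R : R).
Proof.
move=> mA; under eq_fun do rewrite card_hits.
by apply: measurable_sum => i; apply: measurableT_comp.
Qed.

Lemma prob_inE A : measurable A -> P (X @^-1` A) = (prob_in A)%:E.
Proof.
move=> mA; rewrite fineK// fin_num_measure//.
by rewrite -[Y in measurable Y]setTI; exact: mX.
Qed.

Lemma prob_in_ge0 A : (0 <= prob_in A)%R.
Proof. exact: fine_ge0. Qed.

(** Each point contributes E exp (- 1_A(X_i)) <= 1 - p / 2 <= exp (- p / 2), where p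
is the mass of A, because exp (- 1) <= 1 / 2. *)
Lemma integral_expN_hits (A : set T) : measurable A ->
  \int[P]_w (expR (- #|hits Xs A w|%:R))%:E <= (expR (- (n%:R * prob_in A / 2)))%:E.
Proof.
move=> mA; have mXA i : measurable (Xs i @^-1` A).
  by rewrite -[Y in measurable Y]setTI; exact: mXs.
pose f (i : 'I_n) x : R := expR (- \1_A x).
have mf i : measurable_fun setT (f i).
  by apply: (measurableT_comp (@measurable_expR R)); exact: measurableT_comp.
have f0 i x : (0 <= f i x)%R by exact: expR_ge0.
have mi i : measurable_fun setT (fun w => (\1_(Xs i @^-1` A) w : R)%:E).
  by apply/measurable_EFinP; exact: measurable_indic.
have mci i : measurable_fun setT (fun w => (\1_(~` (Xs i @^-1` A)) w : R)%:E).
  by apply/measurable_EFinP; apply: measurable_indic; exact: measurableC.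
have fle i : \int[P]_w (f i (Xs i w))%:E <= (expR (- (prob_in A / 2)))%:E.
  apply: (@le_trans _ _ (\int[P]_w ((\1_(~` (Xs i @^-1` A)) w)%:E +
      (1 / 2)%:E * (\1_(Xs i @^-1` A) w)%:E))).
    apply: ge0_le_integral => //.
    - by move=> w _; rewrite lee_fin.
    - by apply/measurable_EFinP; exact: measurableT_comp.
    - by apply: emeasurable_funD => //; exact: measurable_funeM.
    - move=> w _; rewrite -EFinM -EFinD lee_fin /f !indicE.
      have [h|h] := pselect (A (Xs i w)).
        rewrite mem_set// memNset; last by move=> /(_ h).
        rewrite mem_set// add0r mulr1 expRN div1r lef_pV2 ?posrE ?expR_gt0//.
        exact: expR1_ge2.
      by rewrite memNset// mem_set// memNset// oppr0 expR0 mulr0 addr0.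
  have m2 : measurable_fun setT (fun w => (1 / 2)%:E * (\1_(Xs i @^-1` A) w : R)%:E).
    exact: measurable_funeM.
  rewrite ge0_integralD//.
  rewrite ge0_integralZl_EFin//.
  rewrite !integral_indic ?setIT//; last exact: measurableC.
  have PXi : P (Xs i @^-1` A) = (prob_in A)%:E by rewrite lXs// prob_inE.
  have PcXi : P (~` (Xs i @^-1` A)) = (1 - prob_in A)%:E.
    by rewrite probability_setC// PXi.
  rewrite [X in X + _]PcXi [X in _ * X]PXi -EFinM -EFinD lee_fin.
  apply: le_trans (expR_ge1Dx _).
  by move: (prob_in A) => p; lra.
rewrite (_ : \int[P]_w _ = \int[P]_w (\prod_i f i (Xs i w))%:E); last first.
  by apply: eq_integral => w _; rewrite card_hits -sumrN expR_sum.
rewrite (independent_integral_prod mXs iXs mf f0); last first.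
  by move=> i; apply: (le_lt_trans (fle i)); rewrite ltry.
have -> : (expR (- (n%:R * prob_in A / 2)))%:E =
    \prod_(i < n) (expR (- (prob_in A / 2)))%:E.
  rewrite prodEFin prodr_const card_ord -expRM_natl.
  by congr (expR _)%:E; ring.
suff /andP[] : 0 <= \prod_i \int[P]_w (f i (Xs i w))%:E <=
    \prod_(i < n) (expR (- (prob_in A / 2)))%:E by [].
apply: (big_ind2 (fun x y => 0 <= x <= y)) => [|x1 x2 y1 y2|i _].
- by rewrite lee_fin ler01 lexx.
- by move=> /andP[x10 x12] /andP[y10 y12]; rewrite mule_ge0//= lee_pmul.
- by rewrite fle andbT; apply: integral_ge0 => w _; rewrite lee_fin.
Qed.

(** By Markov's inequality the complement has probability at most
exp (n p / 4 - n p / 2) <= exp (- 2) <= 1 / 2. *)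
Lemma hits_lower_tail (A : set T) : measurable A -> (8 <= n%:R * prob_in A)%R ->
  (1 / 2)%:E <= P [set w | (n%:R * prob_in A / 4 < #|hits Xs A w|%:R)%R].
Proof.
move=> mA; set p := (n%:R * prob_in A)%R => p8.
pose D := [set w | (#|hits Xs A w|%:R <= p / 4)%R].
have mh := measurable_card_hits mA.
have mD : measurable D.
  rewrite (_ : D = (fun w => #|hits Xs A w|%:R : R) @^-1` `]-oo, (p / 4)%R]).
    by rewrite -[Y in measurable Y]setTI; exact: mh.
  by apply/seteqP; split => w; rewrite /D /= in_itv.
rewrite (_ : [set w | _] = ~` D); last first.
  by apply/seteqP; split => w; rewrite /D /= ltNge => /negP.
rewrite probability_setC//.
have le : (expR (- (p / 4)))%:E * P D <= (expR (- (p / 2)))%:E.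
  apply: le_trans (integral_expN_hits mA).
  rewrite -integral_cst//.
  have mE : measurable_fun setT (fun w => (expR (- #|hits Xs A w|%:R) : R)%:E).
    apply/measurable_EFinP; apply: (measurableT_comp (@measurable_expR R)).
    exact: measurableT_comp.
  apply: (@le_trans _ _ (\int[P]_(w in D) (expR (- #|hits Xs A w|%:R))%:E)).
    apply: ge0_le_integral => //.
    - by move=> w _; rewrite lee_fin expR_ge0.
    - exact: measurable_funTS.
    - by move=> w /= Dw; rewrite lee_fin ler_expR lerN2.
  apply: ge0_subset_integral => //.
have PDfin : P D \is a fin_num by rewrite fin_num_measure.
rewrite -(fineK PDfin) -EFinB lee_fin.
move: le; rewrite -(fineK PDfin) -EFinM lee_fin => le.
set x := fine _ in le *.
have e0 := expR_gt0 (- (p / 4)).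
have x_le : (x <= expR (- (p / 4)))%R.
  rewrite -(ler_pM2l e0); apply: (le_trans le); rewrite -expRD ler_expR.
  by lra.
have e2 : (expR (- (p / 4)) <= expR (- 2))%R by rewrite ler_expR lerN2; lra.
have e2' : (expR (- 2) <= 1 / 2 :> R)%R.
  rewrite expRN div1r lef_pV2 ?posrE ?expR_gt0//.
  by apply: le_trans (expR_ge1Dx _); lra.
by rewrite /=; lra.
Qed.

Variables (AA : set (set T)) (v : nat) (l : R).
Hypotheses (vcAA : has_vc_dim AA v) (mAA : @measurable_class R _ T AA).
Hypothesis l1 : (1 <= l)%R.

(** Symmetrization.  Let D be the event of [ghost_unbalanced] and G the set of those
w for which the section of D at w has probability at least 1/2, so that P G is at
most twice the probability of D.  If the sample at w has fewer than n p / 1020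
points in A, where p is the mass of A, then w belongs to G: by [hits_lower_tail]
the second sample has more than n p / 4 >= 2 l points in A with probability at
least 1/2, and this is more than 1020 / 4 = 255 times the number of the first. *)
Lemma mass_bound : exists G : set Omega,
  [/\ measurable G, P G <= (2 * expR (- l) * ((n + n).+1 ^ v)%:R)%:E &
      forall w, ~ G w -> forall A, AA A -> measurable A ->
        (8 * l <= n%:R * prob_in A)%R ->
        (n%:R * prob_in A / 1020 <= #|hits Xs A w|%:R)%R].
Proof.
have [D [mD PD DP]] := ghost_unbalanced mXs iXs lXs l vcAA mAA.
pose phi w := P (xsection D w).
have mphi : measurable_fun setT phi by exact: measurable_fun_xsection.
pose G := [set w | (1 / 2)%:E <= phi w].
have mG : measurable G.
  by rewrite -[G]setTI; exact: emeasurable_fun_c_infty.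
exists G; split => //.
- have : (1 / 2)%:E * P G <= (P \x P) D.
    rewrite -integral_cst//.
    rewrite (_ : (P \x P) D = \int[P]_w phi w)//.
    apply: (@le_trans _ _ (\int[P]_(w in G) phi w)).
      apply: ge0_le_integral => //.
      - by move=> w _; rewrite lee_fin; lra.
      - exact: measurable_funTS.
    exact: ge0_subset_integral.
  move=> /le_trans/(_ PD).
  have PGfin : P G \is a fin_num by rewrite fin_num_measure.
  rewrite -(fineK PGfin) -EFinM !lee_fin.
  set y := fine _; rewrite /= => h; rewrite -mulrA.
  by move: h; set z := (expR _ * _)%R => h; lra.
- move=> w Gw A AAA mA lp; rewrite leNgt; apply/negP => few; apply: Gw.
  have p8 : (8 <= n%:R * prob_in A)%R by move: l1 lp; lra.
  apply: (le_trans (hits_lower_tail mA p8)).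
  apply: le_measure; rewrite ?inE.
  + rewrite (_ : [set _ | _] = (fun w => #|hits Xs A w|%:R : R) @^-1`
        `](n%:R * prob_in A / 4)%R, +oo[).
      by rewrite -[Y in measurable Y]setTI; exact: measurable_card_hits.
    by apply/seteqP; split => w'; rewrite /= in_itv/= andbT.
  + exact: measurable_xsection.
  move=> w' /= many; rewrite /xsection/= inE.
  pose J := [set k | `[< A (tnth (ghost Xs (w, w')) k) >]]%SET.
  apply: (DP _ J); last first.
    by exists A => // k; rewrite inE; split => /asboolP.
  have lE : left_count J = #|hits Xs A w|.
    rewrite /left_count -sum1_card [RHS]big_mkcond/=; apply: eq_bigr => i _.
    by rewrite !inE ghost_lshift; case: ifP => // ->.
  have rE : right_count J = #|hits Xs A w'|.
    rewrite /right_count -sum1_card [RHS]big_mkcond/=; apply: eq_bigr => i _.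
    by rewrite !inE ghost_rshift; case: ifP => // ->.
  rewrite /unbalanced lE rE -(ltr_nat R) natrM.
  by apply/andP; split; move: few many lp; lra.
Qed.

End mass_bound.

(** * Euclidean distance, Lipschitz constants and the local error *)

Local Notation edist := Defs.edist.

Section euclidean_facts.
Context {R : realType} {d : nat}.
Implicit Types (x y : d.-tuple R) (V : set (d.-tuple R)) (g : d.-tuple R -> R).

Lemma eucl_dist_ge0 x y : 0 <= edist x y.
Proof. exact: sqrtr_ge0. Qed.

Lemma eucl_dist_eq0 x y : edist x y = 0 -> x = y.
Proof.
move=> /eqP; rewrite sqrtr_eq0 => le0.
have ge0 (i : 'I_d) : true -> 0 <= (tnth x i - tnth y i) ^+ 2.
  by move=> _; exact: sqr_ge0.
have /eqP : \sum_(i < d) (tnth x i - tnth y i) ^+ 2 = 0.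
  by apply/eqP; rewrite eq_le le0 sumr_ge0.
rewrite psumr_eq0// => /allP h; apply: eq_from_tnth => i.
have := h i (mem_index_enum i); rewrite sqrf_eq0 subr_eq0 => /eqP.
exact.
Qed.

Lemma eucl_dist_pow_le V x y (c : \bar R) :
  V x -> V y -> (ediam V ^+ d <= c)%E -> ((edist x y ^+ d)%:E <= c)%E.
Proof.
move=> Vx Vy; apply: le_trans.
have le : ((edist x y)%:E <= ediam V)%E.
  by apply: ereal_sup_ubound; exists (x, y).
rewrite EFin_expe; have : forall k, ((edist x y)%:E ^+ k <= ediam V ^+ k)%E; last exact.
elim=> [|k IH]; first by rewrite !expe0.
rewrite !expeS; apply: lee_pmul => //; rewrite ?lee_fin ?eucl_dist_ge0//.
by rewrite expe_ge0// lee_fin eucl_dist_ge0.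
Qed.

Lemma elipschitz_max (L : R) V g : elipschitz L V g -> elipschitz (Num.max L 0) V g.
Proof.
move=> gL x y Vx Vy; apply: (le_trans (gL x y Vx Vy)).
by apply: ler_wpM2r; rewrite ?eucl_dist_ge0// le_max lexx.
Qed.

Lemma lipschitz_const_ge0 g V : 0 <= lipschitz_const g V.
Proof.
rewrite /lipschitz_const; set A := [set l | _].
have [->|A0] := eqVneq A set0; first by rewrite inf0.
by apply: lb_le_inf; [exact/set0P|move=> l []].
Qed.

Lemma lipschitz_const_le (L : R) V g : 0 <= L -> elipschitz L V g ->
  lipschitz_const g V <= L.
Proof. by move=> L0 gL; apply: ge_inf; [exists 0 => l []|split]. Qed.

(** Each pair at positive distance bounds every admissible constant from below by a
quotient, hence also the infimum. *)
Lemma elipschitz_const (L : R) V g : elipschitz L V g ->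
  elipschitz (lipschitz_const g V) V g.
Proof.
move=> gL x y Vx Vy.
have := eucl_dist_ge0 x y; rewrite le_eqVlt => /orP[/eqP exy|exy].
  by rewrite -exy mulr0 (eucl_dist_eq0 (esym exy)) subrr normr0.
rewrite -ler_pdivrMr//; apply: lb_le_inf.
  exists (Num.max L 0); split; first by rewrite le_max lexx orbT.
  exact: elipschitz_max.
by move=> l [_ /(_ x y Vx Vy)]; rewrite ler_pdivrMr.
Qed.

Lemma elipschitz_subset (L : R) V W g : V `<=` W ->
  elipschitz L W g -> elipschitz L V g.
Proof. by move=> VW gL x y /VW Wx /VW Wy; exact: gL. Qed.

Lemma lebesgue_vec_set1 x : (0 < d)%N -> lebesgue_vec [set x] = 0%E.
Proof.
move=> d0; rewrite (_ : [set x] =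
    [set y | forall i, [set tnth x i] (tnth y i)]); last first.
  by apply/seteqP; split => [y -> //|y h]; apply: eq_from_tnth => i; exact: h.
rewrite (lebesgue_vec_box (B := fun i => [set tnth x i])); last first.
  by move=> i; exact: measurable_set1.
by rewrite (bigD1 (Ordinal d0))//= lebesgue_measure_set1 mul0e.
Qed.

(** A negative constant forces V to be a single point, which has volume 0. *)
Lemma elipschitz_ge0 (L : R) V g : (0 < d)%N -> (0 < lebesgue_vec V)%E ->
  elipschitz L V g -> 0 <= L.
Proof.
move=> d0 V0 gL; rewrite leNgt; apply/negP => Ln.
have [x Vx] : exists x, V x.
  by apply/set0P; apply: contraTneq V0 => ->; rewrite measure0 ltxx.
suff V1 : V = [set x] by move: V0; rewrite V1 lebesgue_vec_set1// ltxx.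
apply/seteqP; split => [y Vy|y -> //]; apply: eucl_dist_eq0; apply/eqP.
rewrite eq_le eucl_dist_ge0 andbT leNgt; apply/negP => yx0.
have := le_trans (normr_ge0 _) (gL _ _ Vy Vx).
by rewrite leNgt nmulr_rlt0// yx0.
Qed.

End euclidean_facts.

Section local_error.
Context {R : realType} {d n : nat}.
Variables (xs : 'I_n -> d.-tuple R) (ys : 'I_n -> R).
Variables (V : d.-tuple R -> set (d.-tuple R)) (g : d.-tuple R -> R).
Variable x : d.-tuple R.

Lemma local_estimator_error (N S D : R) :
  N = \sum_i \1_(V x) (xs i) -> 0 < N ->
  `|\sum_i (ys i - g (xs i)) * \1_(V x) (xs i)| <= S ->
  (forall y, V x y -> `|g y - g x| <= D) ->
  `|local_estimator xs ys V x - g x| <= S / N + D.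
Proof.
move=> NE N0 noise bias; rewrite /local_estimator -NE.
have -> : (\sum_i ys i * \1_(V x) (xs i)) / N - g x =
    (\sum_i (ys i - g (xs i)) * \1_(V x) (xs i)) / N +
    (\sum_i (g (xs i) - g x) * \1_(V x) (xs i)) / N.
  rewrite -mulrDl -big_split/=.
  have gxE : g x = g x * N / N by rewrite mulfK// gt_eqF.
  rewrite {1}gxE.
  rewrite -mulrBl; congr (_ / _); rewrite NE mulr_sumr -sumrB.
  by apply: eq_bigr => i _; ring.
apply: (le_trans (ler_normD _ _)); apply: lerD.
  by rewrite normrM (gtr0_norm (_ : 0 < N^-1)) ?invr_gt0// ler_pM2r ?invr_gt0.
rewrite normrM (gtr0_norm (_ : 0 < N^-1)) ?invr_gt0// ler_pdivrMr//.
apply: (le_trans (ler_norm_sum _ _ _)); rewrite NE mulr_sumr; apply: ler_sum => i _.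
rewrite normrM indicE; have [h|h] := pselect (V x (xs i)).
  by rewrite mem_set// normr1 !mulr1; exact: bias.
by rewrite memNset// normr0 !mulr0.
Qed.

End local_error.

(** * The good event and the rates *)

Section good_event.
Context (R : realType) d d' (Omega : measurableType d) (T : measurableType d').
Variables (P : probability Omega R) (X : Omega -> T) (Y : Omega -> R).
Variables (n : nat) (Xs : 'I_n -> Omega -> T) (Ys : 'I_n -> Omega -> R).
Hypotheses (mX : measurable_fun setT X) (mY : measurable_fun setT Y).
Hypothesis mXs : forall i, measurable_fun setT (Xs i).
Hypothesis mYs : forall i, measurable_fun setT (Ys i).
Hypothesis iid : iid_copies P (fun w => (X w, Y w)) (fun i w => (Xs i w, Ys i w)).
Variables (g : T -> R) (s2 : R).
Hypothesis mg : measurable_fun setT g.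
Hypothesis s20 : 0 <= s2.
Hypothesis sg : cond_sub_gaussian P X (fun w => Y w - g (X w)) s2.
Variables (AA : set (set T)) (v : nat) (delta : R).
Hypotheses (vcAA : has_vc_dim AA v) (mAA : @measurable_class R _ T AA).
Hypotheses (delta0 : 0 < delta) (delta1 : delta < 1 / 3).

Lemma independent_fst : mutually_independent P Xs.
Proof.
move=> J B mB.
have := iid.1 J (fun i => B i `*` setT) (fun i => measurableX (mB i) measurableT).
rewrite (_ : [set w | _] = [set w | forall i, i \in J -> B i (Xs i w)]); last first.
  by apply/seteqP; split => w /= h i /h => [[]|].
move=> ->; apply: eq_bigr => i _; congr (P _).
by apply/seteqP; split => w /= => [[]|].
Qed.

Lemma same_law_fst i B : measurable B -> P (Xs i @^-1` B) = P (X @^-1` B).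
Proof.
move=> mB; have := iid.2 i (B `*` setT) (measurableX mB measurableT).
rewrite (_ : _ @^-1` _ = Xs i @^-1` B); last first.
  by apply/seteqP; split => w /= => [[]|].
by move=> ->; congr (P _); apply/seteqP; split => w /= => [[]|].
Qed.

(** The noise bound fails with probability at most 2 (n + 1)^v exp (- l) = 2 delta
for l = log ((n + 1)^v / delta), the mass bound with probability at most
2 (2n + 1)^v exp (- l') = delta / 2 for l' = log (4 (2n + 1)^v / delta). *)
Lemma good_event : exists F : set Omega,
  [/\ measurable F, ((1 - 3 * delta)%:E <= P F)%E &
   forall w, F w -> forall A, AA A ->
    `|\sum_(i in hits Xs A w) noise Xs Ys g i w| <=
      Num.sqrt (2 * #|hits Xs A w|%:R * s2 * ln (n.+1%:R ^+ v / delta)) /\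
    (measurable A ->
     8 * ln (4 * (2 * n + 1)%:R ^+ v / delta) <= n%:R * prob_in P X A ->
     n%:R * prob_in P X A / 1020 <= #|hits Xs A w|%:R)].
Proof.
have [d0 d1] := (delta0, delta1).
set L := ln (_.+1%:R ^+ _ / _); set l := ln (4 * _ / _).
have pow1 k : 1 <= (k.+1)%:R ^+ v :> R by rewrite exprn_ege1// ler1n.
have argL : 3 < n.+1%:R ^+ v / delta.
  by rewrite ltr_pdivlMr//; apply: lt_le_trans (pow1 n); lra.
have argl : 12 < 4 * (2 * n + 1)%:R ^+ v / delta.
  rewrite ltr_pdivlMr// addn1; have := pow1 (2 * n)%N.
  by set a := _ ^+ v => a1; lra.
have L0 : 0 < L by apply: ln_gt0; lra.
have l1 : 1 <= l.
  rewrite -(expRK 1) ler_ln ?posrE ?expR_gt0//; last by lra.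
  (* exp (1/2) = 1 / exp (- 1/2) <= 1 / (1 - 1/2) *)
  have e4 : expR 1 <= 4 :> R.
    have -> : expR 1 = expR (1 / 2) ^+ 2 :> R.
      by rewrite -expRM_natl; congr expR; field.
    have -> : expR (1 / 2) = (expR (- (1 / 2)))^-1 :> R by rewrite expRN invrK.
    have h : 1 / 2 <= expR (- (1 / 2)) :> R.
      by apply: le_trans (expR_ge1Dx _); lra.
    have h' : (expR (- (1 / 2)))^-1 <= 2 :> R.
      rewrite -[leRHS]invrK lef_pV2 ?posrE ?expR_gt0 ?invr_gt0//.
      by apply: le_trans h; lra.
    rewrite (_ : 4 = 2 ^+ 2); last by ring.
    by rewrite lerXn2r ?nnegrE ?invr_ge0 ?expR_ge0.
  by lra.
have eL : expR (- L) = delta / n.+1%:R ^+ v.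
  by rewrite expRN lnK ?posrE ?invf_div//; lra.
have el : expR (- l) = delta / (4 * (2 * n + 1)%:R ^+ v).
  by rewrite expRN lnK ?posrE ?invf_div//; lra.
have [G1 [mG1 PG1 G1P]] := mass_bound mX mXs independent_fst same_law_fst vcAA mAA l1.
have [G2 [mG2 PG2 G2P]] :=
  noise_uniform mX mY mXs mYs iid mg s20 sg vcAA mAA L0.
exists (~` (G1 `|` G2)); split.
- by apply: measurableC; exact: measurableU.
- rewrite probability_setC; last exact: measurableU.
  have PU : (P (G1 `|` G2) <= (3 * delta)%:E)%E.
    apply: (le_trans (measureU2 _ mG1 mG2)); apply: (le_trans (leeD PG1 PG2)).
    rewrite -EFinD lee_fin eL el !natrX addnn -mul2n -addn1.
    have := pow1 n; have := pow1 (2 * n)%N; rewrite -(addn1 (2 * n)).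
    set a := _ ^+ v; set b := _ ^+ v => a1 b1.
    have -> : 2 * (delta / (4 * a)) * a + 2 * (delta / b) * b = delta / 2 + 2 * delta.
      by field; apply/andP; split; apply/lt0r_neq0; lra.
    by lra.
  have Pfin : P (G1 `|` G2) \is a fin_num.
    by rewrite fin_num_measure//; exact: measurableU.
  by move: PU; rewrite -(fineK Pfin) -EFinB !lee_fin /= => h; lra.
- move=> w /not_orP[nG1 nG2] A AAA; split; first exact: G2P.
  by move=> mA; exact: G1P.
Qed.

End good_event.

(** Here r = (l/n)^(d/(d+2)) and u = (l/n)^(1/(d+2)), so that l = n r u^2; N is a
number of points that is at least the mass forced by the volume r / ap, up to the
factor K. *)
Lemma noise_rate (R : realType) (K kappa f ap n r u s2 N C : R) :
  1 <= K ->   0 < kappa -> 0 < f -> 1 <= ap -> 0 < n -> 0 < r -> 0 < u -> 0 <= s2 ->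
  K * ap <= C -> n * (kappa * f * (r / ap)) / K <= N ->
  Num.sqrt (2 * N * s2 * (n * (r * u ^+ 2))) / N <=
  C * Num.sqrt (3 * s2 / (kappa * f)) * u.
Proof.
move=> K1 k0 f0 ap1 n0 r0 u0 s20 CC NN.
have ap0 : 0 < ap by lra.
have K0 : 0 < K by lra.
have kf0 : 0 < kappa * f by rewrite mulr_gt0.
have N0 : 0 < N.
  by apply: lt_le_trans NN; rewrite divr_gt0// !mulr_gt0// invr_gt0.
have C0 : 0 <= C by apply: le_trans CC; rewrite mulr_ge0 ?ltW.
rewrite -ler_sqr ?nnegrE ?divr_ge0 ?mulr_ge0 ?sqrtr_ge0 ?(ltW N0) ?(ltW u0)//.
rewrite expr_div_n !exprMn !sqr_sqrtr; last 2 first.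
- by rewrite divr_ge0 ?mulr_ge0 ?(ltW k0) ?(ltW f0).
- by rewrite !mulr_ge0 ?exprn_ge0 ?(ltW N0) ?(ltW n0) ?(ltW r0) ?(ltW u0).
rewrite ler_pdivrMr ?exprn_gt0//.
have -> : 2 * N * s2 * (n * (r * u ^+ 2)) = (2 * s2 * u ^+ 2 * N) * (n * r) by ring.
have nr : n * r <= K * ap / (kappa * f) * N.
  rewrite mulrAC ler_pdivlMr//.
  have -> : n * r * (kappa * f) = K * ap * (n * (kappa * f * (r / ap)) / K).
    by field; rewrite !gt_eqF.
  by rewrite ler_pM2l// mulr_gt0.
apply: (@le_trans _ _ ((2 * s2 * u ^+ 2 * N) * (K * ap / (kappa * f) * N))).
  by apply: ler_wpM2l => //; rewrite !mulr_ge0 ?exprn_ge0 ?(ltW N0) ?(ltW u0).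
have -> : 2 * s2 * u ^+ 2 * N * (K * ap / (kappa * f) * N) =
    (2 * (K * ap)) * (s2 / (kappa * f) * u ^+ 2 * N ^+ 2) by field; rewrite !gt_eqF.
have -> : C ^+ 2 * (3 * s2 / (kappa * f)) * u ^+ 2 * N ^+ 2 =
    (3 * C ^+ 2) * (s2 / (kappa * f) * u ^+ 2 * N ^+ 2) by field; rewrite !gt_eqF.
apply: ler_wpM2r.
  by rewrite !mulr_ge0 ?exprn_ge0 ?invr_ge0 ?(ltW N0) ?(ltW u0) ?(ltW kf0).
have := mulr_ege1 K1 ap1; move: CC; set z := K * ap => zC z1.
have C1 : 1 <= C by lra.
by nra.
Qed.

(** Here u^d = (l/n)^(d/(d+2)).  The factor am^(-1/d) is replaced by the larger
am^(-1), which does not depend on d. *)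
Lemma bias_rate (R : realType) (am gamma lam e : R) (d : nat) (u : R) :
  0 < am -> am <= 1 -> (0 < d)%N -> 0 <= gamma -> 0 <= e -> 0 <= u ->
  am * lam <= u ^+ d -> e ^+ d <= gamma * lam ->
  e <= am^-1 * gamma `^ d%:R^-1 * u.
Proof.
move=> am0 am1 d0 g0 e0 u0 lamu elam.
have rhs0 : 0 <= am^-1 * gamma `^ d%:R^-1 * u.
  by rewrite !mulr_ge0 ?invr_ge0 ?powR_ge0 ?(ltW am0).
rewrite -(ler_pXn2r d0) ?nnegrE//; apply: (le_trans elam).
rewrite !exprMn -(powR_mulrn _ (powR_ge0 _ _)) -powRrM mulVf ?pnatr_eq0 -?lt0n//.
rewrite powRr1//.
have lam_le : lam <= am^-1 * u ^+ d by rewrite ler_pdivlMl.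
have am_le : am^-1 <= am^-1 ^+ d.
  by rewrite -[leLHS]expr1; apply: ler_weXn2l => //; rewrite invf_ge1.
apply: (@le_trans _ _ (gamma * (am^-1 * u ^+ d))); first exact: ler_wpM2l.
rewrite mulrCA -mulrA; apply: ler_wpM2r => //.
by rewrite mulr_ge0// exprn_ge0.
Qed.

Theorem theorem12 (R : realType) (am ap : R)
    (ham0 : 0 < am) (ham1 : am <= 1) (hap1 : 1 <= ap) :
  exists2 C : R, 0 < C &
  forall (d : nat) (hd : (0 < d)%N)
    (dO : measure_display) (Omega : measurableType dO)
    (P : probability Omega R)
    (X : {RV P >-> d.-tuple R}) (Y : {RV P >-> R})
    (n : nat) (hn : (0 < n)%N)
    (Xs : 'I_n -> {RV P >-> d.-tuple R}) (Ys : 'I_n -> {RV P >-> R})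
    (hiid : iid_copies P (fun w => (X w, Y w)) (fun i w => (Xs i w, Ys i w)))
    (SX : set (d.-tuple R)) (mSX : measurable SX) (hX : forall w, SX (X w))
    (g : d.-tuple R -> R) (hg : is_cond_exp P X Y g)
    (delta : R) (hdelta0 : 0 < delta) (hdelta1 : delta < 1 / 3)
    (sigma : R)
    (heps : cond_sub_gaussian P X (fun w => Y w - g (X w)) (sigma ^+ 2))
    (L : R) (hL : elipschitz L SX g)
    (V : Omega -> d.-tuple R -> set (d.-tuple R))
    (hV : forall w, local_map SX (V w))
    (v : nat) (hv : (0 < v)%N)
    (AA : set (set (d.-tuple R)))
    (hAA : has_vc_dim AA v) (mAA : @measurable_class R _ (d.-tuple R) AA)
    (hVC : {ae P, forall w, forall x, SX x -> AA (V w x)})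
    (hlarge : {ae P, forall w, forall x, SX x ->
       ((8 * ln (4 * (2 * n + 1)%:R ^+ v / delta))%:E <=
        n%:R%:E * maxe (empirical_measure (fun i => Xs i w) (V w x))%:E
                       (distribution P X (V w x)))%E})
    (kappa : R) (hkappa : 0 < kappa)
    (fX : d.-tuple R -> R) (hfX : is_density X fX)
    (hmass : {ae P, forall w, forall x, SX x ->
       ((kappa * fX x)%:E * lebesgue_vec (V w x) <=
        distribution P X (V w x))%E})
    (gamma : R) (hgamma : 0 < gamma)
    (hshape : {ae P, forall w, forall x, SX x ->
       (ediam (V w x) ^+ d <= gamma%:E * lebesgue_vec (V w x))%E})
    (hvol : {ae P, forall w, forall x, SX x ->
       (am%:E * lebesgue_vec (V w x) <=
          (log_ratio n v delta `^ (d%:R / (d%:R + 2)))%:E)%E /\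
       ((log_ratio n v delta `^ (d%:R / (d%:R + 2)))%:E <=
          ap%:E * lebesgue_vec (V w x))%E}),
  with_prob_ge P (1 - 3 * delta) (fun w => forall x, SX x ->
    (`|local_estimator (fun i => Xs i w) (fun i => Ys i w) (V w) x - g x|%:E <=
     if (fX x == 0)%R then +oo else
       (C * (Num.sqrt (3 * sigma ^+ 2 / (kappa * fX x))
             + lipschitz_const g (V w x) * gamma `^ d%:R^-1)
        * log_ratio n v delta `^ (d%:R + 2)^-1)%:E)%E)
  /\
  (forall b : R, ebounded SX -> 0 < b -> (forall x, SX x -> b <= fX x) ->
   with_prob_ge P (1 - 3 * delta) (fun w =>
     (ereal_sup [set `|local_estimator (fun i => Xs i w) (fun i => Ys i w)
                        (V w) x - g x|%:E | x in SX] <=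
      (C * (Num.sqrt (3 * sigma ^+ 2 / (kappa * b)) + L * gamma `^ d%:R^-1)
       * log_ratio n v delta `^ (d%:R + 2)^-1)%:E)%E)).
Proof.
(* of the constant in [mass_bound], only 1 <= K matters from here on *)
have [K [K1 KE]] : exists K : R, 1 <= K /\ forall c, c / 1020 = c / K.
  by exists 1020; split => //; rewrite ler1n.
have am_gt0 := ham0; have ap_ge1 := hap1.
have ap0 : 0 < ap by lra.
have K0 : 0 < K by lra.
exists (am^-1 + K * ap); first by rewrite addr_gt0 ?invr_gt0 ?mulr_gt0//; lra.
move=> d hd dO Omega P X Y n hn Xs Ys hiid SX mSX hX g hg delta hdelta0 hdelta1.
move=> sigma heps L hL V hV v hv AA hAA mAA hVC hlarge kappa hkappa fX hfX hmass.
move=> gamma hgamma hshape hvol.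
set C := am^-1 + _; set u := _ `^ (_ + 2)^-1.
have n0 : 0 < n%:R :> R by rewrite ltr0n.
have Lam0 : 0 < ln (n.+1%:R ^+ v / delta).
  apply: ln_gt0; rewrite ltr_pdivlMr//.
  have h : 1 <= n.+1%:R ^+ v :> R by rewrite exprn_ege1// ler1n.
  by apply: lt_le_trans h; lra.
have ell0 : 0 < log_ratio n v delta by rewrite divr_gt0.
have u0 : 0 < u by exact: powR_gt0.
set r := _ `^ (d%:R / (d%:R + 2)) in hvol.
have r0 : 0 < r by exact: powR_gt0.
have ud : u ^+ d = r.
  by rewrite -powR_mulrn ?powR_ge0// -powRrM mulrC.
have d20 : d%:R + 2 != 0 :> R by rewrite gt_eqF// ltr_wpDl.
have ellE : log_ratio n v delta = r * u ^+ 2.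
  rewrite -powR_mulrn ?powR_ge0// -powRrM -powRD ?(gt_eqF ell0) ?implybT//.
  rewrite -[LHS]powRr1 ?(ltW ell0)//; congr (_ `^ _).
  by rewrite [_^-1 * _]mulrC -mulrDl divff.
have LamE : ln (n.+1%:R ^+ v / delta) = n%:R * (r * u ^+ 2).
  by rewrite -ellE /log_ratio [RHS]mulrC divfK// gt_eqF.
have C1 : am^-1 <= C by rewrite /C lerDl mulr_ge0//; lra.
have C2 : K * ap <= C by rewrite /C lerDr invr_ge0 ltW.
have C0 : 0 <= C by apply: le_trans C1; rewrite invr_ge0 ltW.
have mg : measurable_fun setT g by case: hg.
have [F [mF PF Fgood]] : exists F : set Omega,
    [/\ measurable F, ((1 - 3 * delta)%:E <= P F)%E &
     forall w, F w -> forall x, SX x -> fX x != 0 ->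
      `|local_estimator (fun i => Xs i w) (fun i => Ys i w) (V w) x - g x| <=
       C * (Num.sqrt (3 * sigma ^+ 2 / (kappa * fX x))
             + lipschitz_const g (V w x) * gamma `^ d%:R^-1) * u].
  have mX : measurable_fun setT X by [].
  have mY : measurable_fun setT Y by [].
  have mXs i : measurable_fun setT (Xs i) by [].
  have mYs i : measurable_fun setT (Ys i) by [].
  have [F [mF PF Fgood]] := good_event mX mY
    mXs mYs hiid mg (sqr_ge0 sigma) heps hAA mAA hdelta0 hdelta1.
  have [N [mN PN Nsub]] :=
    filterI hVC (filterI hlarge (filterI hmass (filterI hshape hvol))).
  exists (F `\` N); split.
  - exact: measurableD.
  - apply: (le_trans PF); apply: (@le_trans _ _ (P ((F `\` N) `|` N))).
      apply: le_measure; rewrite ?inE//.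
        by apply: measurableU => //; exact: measurableD.
      by move=> w Fw; have [Nw|Nw] := pselect (N w); [right|left].
    apply: (le_trans (measureU2 _ (measurableD mF mN) mN)).
    by rewrite [X in (_ + X)%E]PN adde0.
  - move=> w [Fw Nw] x Sx fx0.
    have /contrapT[VC [large [mass [shape vol]]]] := fun h => Nw (Nsub w h).
    have [mV VS Vxx Vpos] := hV w x Sx.
    have fx_gt0 : 0 < fX x by case: hfX => _ f0 _; rewrite lt0r fx0 f0.
    have [lam lamE] : exists lam : R, lebesgue_vec (V w x) = lam%:E.
      have [le _] := vol x Sx; move: le Vpos.
      case: (lebesgue_vec (V w x)) => [lam| |] //; first by exists lam.
      by rewrite gt0_muley ?lte_fin// leye_eq.
    have [vol1 vol2] := vol x Sx.
    rewrite lamE -EFinM lee_fin in vol1.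
    rewrite lamE -EFinM lee_fin in vol2.
    have pE : distribution P X (V w x) = (prob_in P X (V w x))%:E by exact: prob_inE.
    set p := prob_in _ _ _ in pE.
    have p0 : 0 <= p by exact: prob_in_ge0.
    have := mass x Sx; rewrite pE lamE -EFinM lee_fin => {}mass.
    have := large x Sx; rewrite pE -EFin_max -EFinM lee_fin => {}large.
    have [noiseb massb] := Fgood w Fw (V w x) (VC x Sx).
    have {}massb := massb mV.
    rewrite -/p in massb; rewrite KE in massb.
    set M := #|_|%:R in noiseb massb.
    have ME : M = \sum_i \1_(V w x) (Xs i w) by exact: card_hits.
    (* if the empirical mass is the larger of the two, it bounds p directly *)
    have pM : n%:R * p / K <= M.
      have [ep|pe] := leP (empirical_measure (fun i => Xs i w) (V w x)) p.
        by apply: massb; move: large; rewrite max_r.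
      have npM : n%:R * p <= M.
        rewrite ME -[leRHS](mulVKf (lt0r_neq0 n0)).
        by rewrite ler_pM2l// ltW.
      by apply: le_trans npM; rewrite ler_pdivrMr ?ler_peMr ?mulr_ge0 ?(ltW n0).
    have lower : n%:R * (kappa * fX x * (r / ap)) / K <= M.
      apply: le_trans pM; rewrite ler_pM2r ?invr_gt0//.
      rewrite ler_pM2l//; apply: le_trans mass; rewrite ler_pM2l ?mulr_gt0//.
      by rewrite ler_pdivrMr// mulrC.
    have M0 : 0 < M.
      by apply: lt_le_trans lower; rewrite !mulr_gt0 ?invr_gt0.
    pose D := lipschitz_const g (V w x) * (am^-1 * gamma `^ d%:R^-1 * u).
    apply: (@le_trans _ _
        (Num.sqrt (2 * M * sigma ^+ 2 * (n%:R * (r * u ^+ 2))) / M + D)).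
      apply: local_estimator_error => //.
        rewrite -LamE; apply: le_trans noiseb.
        rewrite [in leRHS]big_mkcond/= le_eqVlt; apply/orP; left; apply/eqP.
        congr `|_|; apply: eq_bigr => i _; rewrite inE indicE /noise.
        have [h|h] := pselect (V w x (Xs i w)).
          by rewrite asboolT// mem_set// mulr1.
        by rewrite asboolF// memNset// mulr0.
      move=> y Vy.
      have Lip := elipschitz_const (elipschitz_subset VS hL).
      apply: (le_trans (Lip y x Vy Vxx)); apply: ler_wpM2l.
        exact: lipschitz_const_ge0.
      apply: (@bias_rate _ _ _ lam) => //;
        rewrite ?eucl_dist_ge0 ?(ltW hgamma) ?(ltW u0) ?ud//.
      have := eucl_dist_pow_le Vy Vxx (shape x Sx).
      by rewrite lamE -EFinM lee_fin.
    rewrite [leRHS]mulrAC mulrDr; apply: lerD.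
      rewrite [leRHS]mulrAC; apply: (@noise_rate _ K _ _ ap) => //.
      exact: sqr_ge0.
    rewrite /D; have := lipschitz_const_ge0 g (V w x).
    set Lc := lipschitz_const _ _ => Lc0.
    have -> : Lc * (am^-1 * gamma `^ d%:R^-1 * u) = am^-1 * (Lc * gamma `^ d%:R^-1 * u).
      by ring.
    rewrite -[leRHS]mulrA [u * _]mulrC; apply: ler_wpM2r => //.
    by rewrite !mulr_ge0 ?powR_ge0 ?(ltW u0).
split.
- exists F; split => // w Fw x Sx.
  by case: ifP => [_|/negbT fx0]; [rewrite leey|rewrite lee_fin Fgood].
- move=> b SXb b0 bf; exists F; split => // w Fw.
  apply: ub_ereal_sup => _ [x Sx <-]; rewrite lee_fin.
  have fx0 : 0 < fX x by apply: lt_le_trans (bf x Sx).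
  apply: (le_trans (Fgood w Fw x Sx (lt0r_neq0 fx0))).
  apply: ler_wpM2r; first exact: ltW.
  apply: ler_wpM2l => //; apply: lerD.
    apply: ler_wsqrtr; apply: ler_wpM2l; first by rewrite mulr_ge0// sqr_ge0.
    by rewrite lef_pV2 ?posrE ?mulr_gt0// ler_pM2l// bf.
  apply: ler_wpM2r; first exact: powR_ge0.
  have [mV VS Vxx Vpos] := hV w x Sx.
  have hLV := elipschitz_subset VS hL.
  by apply: lipschitz_const_le => //; exact: elipschitz_ge0 hLV.
Qed.
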